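(* Let $\{\mathcal{G}_\epsilon:\epsilon\in I\}$ be an $s$-constant deformation of a Lie groupoid $\mathcal{G}\rightrightarrows M$, and let $\xi_0(g,h)=\frac{d}{d\epsilon}\big|_{\epsilon=0}\bar m_\epsilon(gh,h)\in T_g\mathcal{G}$ for $(g,h)\in\mathcal{G}^{(2)}$ (where $gh$ is the product in $\mathcal{G}=\mathcal{G}_0$). Then $\xi_0\in C^2_{\mathrm{def}}(\mathcal{G})$ is a cocycle, and its cohomology class $[\xi_0]\in H^2_{\mathrm{def}}(\mathcal{G})$ depends only on the equivalence class of the deformation.
   Context: Notation. For a Lie groupoid $\mathcal{G}\rightrightarrows M$, $s,t,m,u,i$ are the source, target, multiplication, unit and inversion; $gh$ is defined when $s(g)=t(h)$; $g:x\to y$ means $x=s(g)$, $y=t(g)$; $\mathcal{G}^{(k)}=\{(g_1,\dots,g_k): s(g_i)=t(g_{i+1})\}$; $\bar m(p,q)=pq^{-1}$ for $s(p)=s(q)$ (division map). For $g:x\to y$, $r_g$ and $l_g$ are the differentials of right translation $s^{-1}(y)\to s^{-1}(x)$ and left translation $t^{-1}(x)\to t^{-1}(y)$. The Lie algebroid $A$ has fibres $A_x=T_{1_x}s^{-1}(x)$ and anchor $\rho=dt|_A:A\to TM$. For $\alpha\in\Gamma(A)$ put $\overrightarrow{\alpha}(g)=r_g\alpha_{t(g)}$ and $\overleftarrow{\alpha}(g)=l_g(di(\alpha_{s(g)}))$. Deformation complex $(C^*_{\mathrm{def}}(\mathcal{G}),\delta)$ with cohomology $H^*_{\mathrm{def}}(\mathcal{G})$.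 For $k\ge 1$, $C^k_{\mathrm{def}}(\mathcal{G})$ consists of smooth maps $c:\mathcal{G}^{(k)}\to T\mathcal{G}$ with $c(g_1,\dots,g_k)\in T_{g_1}\mathcal{G}$ such that $ds(c(g_1,\dots,g_k))=:s_c(g_2,\dots,g_k)$ does not depend on $g_1$; and $$(\delta c)(g_1,\dots,g_{k+1})=-d\bar m\big(c(g_1g_2,g_3,\dots,g_{k+1}),c(g_2,\dots,g_{k+1})\big)+\sum_{i=2}^k(-1)^ic(g_1,\dots,g_ig_{i+1},\dots,g_{k+1})+(-1)^{k+1}c(g_1,\dots,g_k).$$ $C^0_{\mathrm{def}}(\mathcal{G})=\Gamma(A)$ and $\delta(\alpha)=\overrightarrow{\alpha}+\overleftarrow{\alpha}$. Deformations. A strict deformation of $\mathcal{G}$ is a family $\{\mathcal{G}_\epsilon\}$ of Lie groupoid structures $(s_\epsilon,t_\epsilon,m_\epsilon,i_\epsilon,u_\epsilon)$ on the fixed manifolds $\mathcal{G}$ and $M$, smooth in $\epsilon$ in an open interval $I\ni 0$, with $\mathcal{G}_0=\mathcal{G}$ as groupoids. It is $s$-constant if $s_\epsilon=s$ for all $\epsilon$; then the division maps $\bar m_\epsilon$ of $\mathcal{G}_\epsilon$ are all defined on $\mathcal{G}\times_s\mathcal{G}=\{(p,q):s(p)=s(q)\}$. Two deformations $\{\mathcal{G}_\epsilon\},\{\mathcal{G}'_\epsilon\}$ of $\mathcal{G}$ are equivalent if there are Lie groupoid isomorphisms $\phi^\epsilon:\mathcal{G}_\epsilon\to\mathcal{G}'_\epsilon$,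 smoothly parametrized by $\epsilon$ in an open interval containing $0$, with $\phi^0=\mathrm{Id}$. *)

(* Defs.v *)
From HB Require Import structures.
From mathcomp Require Import all_boot all_order all_algebra.
From mathcomp Require Import all_classical all_reals all_analysis.

Set Implicit Arguments.
Unset Strict Implicit.
Unset Printing Implicit Defensive.

Import Order.TTheory GRing.Theory Num.Theory numFieldNormedType.Exports.
Local Open Scope classical_set_scope.
Local Open Scope ring_scope.

(* [A] is meant to be open.  On R^n, quantifying over all directions [v]
   amounts to quantifying over the n partial derivatives. *)
Fixpoint Ck (R : realType) (V W : normedModType R) (k : nat) (A : set V)
    (f : V -> W) : Prop :=
  match k with
  | 0%N => forall x, A x -> {for x, continuous f}
  | k'.+1 => (forall x, A x -> differentiable f x) /\
             (forall v, Ck k' A (fun x => 'D_v f x))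
  end.

Definition Coo (R : realType) (V W : normedModType R) (A : set V)
    (f : V -> W) : Prop := forall k, Ck k A f.

Section CkTheory.
Context {R : realType}.
Implicit Types V W : normedModType R.

Lemma near_eq_differentiable V W (f g : V -> W) (x : V) :
  {near x, f =1 g} -> differentiable f x -> differentiable g x.
Proof.
move=> fg dfx; have [cf fE] := (diff_locallyP x f).1 dfx.
have gE : g \o shift x = cst (g x) + 'd f x +o_ 0 id.
  apply/eqaddoP => e e0; move/eqaddoP : fE => /(_ e e0).
  apply: filterS2; last first.
    move: fg; rewrite [X in X -> _](near_shift 0 x) subr0 => fg; exact: fg.
  move=> y /= fgy; rewrite !fctE /= [y + x]addrC [x + y]addrC in fgy *.
  by rewrite fgy (nbhs_singleton fg).
apply/diff_locallyP.
by rewrite (diff_unique cf gE).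
Qed.

Lemma Ck_ext V W k (A : set V) (f g : V -> W) :
  open A -> (forall x, A x -> f x = g x) -> Ck k A f -> Ck k A g.
Proof.
move=> oA; elim: k f g => [|k IHk] f g fg /=.
  move=> fA x Ax; rewrite /prop_for /continuous_at -(fg x Ax).
  apply: cvg_trans (fA x Ax); apply: near_eq_cvg.
  by have := open_nbhs_nbhs (conj oA Ax); apply: filterS => y Ay; rewrite fg.
move=> [df Df]; have fgx x : A x -> {near x, f =1 g}.
  by move=> Ax; have := open_nbhs_nbhs (conj oA Ax); apply: filterS => y /fg.
split=> [x Ax|v]; first exact: near_eq_differentiable (fgx x Ax) (df x Ax).
by apply: IHk (Df v) => x Ax; apply: near_eq_derive; exact: fgx.
Qed.

Lemma Ck_id V k (A : set V) : Ck k A (@id V).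
Proof.
have Ccst k' W (c : W) : Ck k' A (fun=> c).
  elim: k' c => [|k' IHk] c /=; first by move=> x _; exact: cvg_cst.
  split=> [x _|v]; first exact: differentiable_cst.
  have -> : (fun x : V => 'D_v (fun=> c) x) = (fun=> 0).
    by apply: funext => x; exact: derive_cst.
  exact: IHk.
case: k => [|k] /=; first by move=> x _; exact: cvg_id.
split=> [x _|v]; first by have [] := is_diff_id x.
have -> : (fun x : V => 'D_v id x) = (fun=> v).
  by apply: funext => x; exact: derive_id.
exact: Ccst.
Qed.

Lemma open_setX (T U : topologicalType) (A : set T) (B : set U) :
  open A -> open B -> open (A `*` B).
Proof.
rewrite !openE => oA oB [x y] [/= Ax By].
by exists (A, B) => //; split => /=; [exact: oA | exact: oB].
Qed.

Lemma Ck_prod V V' W W' k (A : set V) (B : set V') (f : V -> W) (g : V' -> W') :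
  open A -> open B -> Ck k A f -> Ck k B g ->
  Ck k (A `*` B) (fun p => (f p.1, g p.2)).
Proof.
move=> oA oB; have oAB := open_setX oA oB.
elim: k f g => [|k IHk] f g /=.
  move=> cf cg [x y] [/= Ax By].
  apply: cvg_pair => /=.
    by apply: cvg_comp; [exact: cvg_fst | exact: cf].
  by apply: cvg_comp; [exact: cvg_snd | exact: cg].
move=> [df Df] [dg Dg].
have d1 (p : V * V') : differentiable (@fst V V') p.
  by apply: linear_differentiable => q; exact: cvg_fst.
have d2 (p : V * V') : differentiable (@snd V V') p.
  by apply: linear_differentiable => q; exact: cvg_snd.
have df1 p : (A `*` B) p -> differentiable (f \o fst) p.
  by move=> [Ap Bp]; apply: differentiable_comp => //; exact: df.
have dg2 p : (A `*` B) p -> differentiable (g \o snd) p.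
  by move=> [Ap Bp]; apply: differentiable_comp => //; exact: dg.
split=> [p ABp|v].
  by apply: differentiable_pair; [exact: df1 | exact: dg2].
apply: Ck_ext (IHk _ _ (Df v.1) (Dg v.2)) => // p ABp.
have [Ap Bp] := ABp.
have dF := differentiable_pair (df1 _ ABp) (dg2 _ ABp).
have dfp : differentiable f (fst p) by exact: df.
have dgp : differentiable g (snd p) by exact: dg.
rewrite /= (deriveE _ dfp) (deriveE _ dgp) (deriveE _ dF).
rewrite (diff_pair (df1 _ ABp) (dg2 _ ABp)) /=.
rewrite (diff_comp (d1 p) dfp) (diff_comp (d2 p) dgp) /=.
rewrite !diff_lin //.
  by move=> q; exact: cvg_snd.
by move=> q; exact: cvg_fst.
Qed.

End CkTheory.
Section Charts.
Context {R : realType}.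
#[local] Obligation Tactic := idtac.

(* [chart_map] and [chart_inv] are total functions, meaningful only on
   [chart_dom] and on its image respectively. *)
Record chart (V : normedModType R) (T : topologicalType) := Chart {
  chart_dom : set T;
  chart_map :> T -> V;
  chart_inv : V -> T;
  chart_dom_open : open chart_dom;
  chart_img_open : open (chart_map @` chart_dom);
  chart_mapK : forall x, chart_dom x -> chart_inv (chart_map x) = x;
  chart_map_continuous : forall x, chart_dom x -> {for x, continuous chart_map};
  chart_inv_continuous :
    forall z, (chart_map @` chart_dom) z -> {for z, continuous chart_inv} }.

Lemma chart_img_open_sub (V : normedModType R) (T : topologicalType)
    (phi : chart V T) (U : set T) :
  open U -> U `<=` chart_dom phi -> open (phi @` U).
Proof.
move=> oU Udom.
have -> : phi @` U = (phi @` chart_dom phi) `&` chart_inv phi @^-1` U.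
  apply/seteqP; split=> [_ [x Ux <-]|_ [[x dx <-]]] /=.
    split; first by exists x => //; exact: Udom.
    by rewrite chart_mapK //; exact: Udom.
  by rewrite chart_mapK // => Ux; exists x.
have := chart_img_open phi; rewrite !openE => oI z [Iz Uz].
apply: filterI; first exact: oI.
by apply: (chart_inv_continuous Iz); exact: open_nbhs_nbhs.
Qed.

(* A set with a C^oo atlas modelled on [V]; [chart_at x] is a chosen chart
   around [x], used to identify the tangent space at [x] with [V]. *)
Record smooth_space (V : normedModType R) := SmoothSpace {
  carrier :> topologicalType;
  atlas : set (chart V carrier);
  chart_at : carrier -> chart V carrier;
  chart_at_atlas : forall x, atlas (chart_at x);
  chart_at_dom : forall x, chart_dom (chart_at x) x;
  atlas_compat : forall phi psi, atlas phi -> atlas psi ->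
    Coo (phi @` (chart_dom phi `&` chart_dom psi)) (psi \o chart_inv phi) }.

#[global] Arguments atlas {V} s _.

Record manifold (n : nat) := Manifold {
  manifold_space :> smooth_space 'rV[R]_n;
  manifold_hausdorff : hausdorff_space manifold_space;
  manifold_second_countable : second_countable (T := manifold_space) }.

Section ModelSpace.
Variable V : normedModType R.

Program Definition id_chart : chart V V :=
  @Chart V V setT id id openT _ _ _ _.
Next Obligation. by rewrite image_id; exact: openT. Qed.
Next Obligation. by []. Qed.
Next Obligation. by move=> *; exact: cvg_id. Qed.
Next Obligation. by move=> *; exact: cvg_id. Qed.

Program Definition model_space : smooth_space V :=
  @SmoothSpace V V [set id_chart] (fun=> id_chart) _ _ _.
Next Obligation. by []. Qed.
Next Obligation. by []. Qed.
Next Obligation. by move=> ? ? -> -> k; exact: Ck_id. Qed.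

End ModelSpace.

Section ProductSpace.
Variables (V W : normedModType R).

Lemma image_prod (T U : Type) (f : T -> V) (g : U -> W) (A : set T) (B : set U) :
  (fun p : T * U => (f p.1, g p.2)) @` (A `*` B) = (f @` A) `*` (g @` B).
Proof.
apply/seteqP; split=> [_ [[x y] [/= Ax By] <-]|[_ _] [/= [x Ax <-] [y By <-]]].
  by split; [exists x | exists y].
by exists (x, y).
Qed.

Program Definition prod_chart (T U : topologicalType) (phi : chart V T)
    (psi : chart W U) : chart (V * W)%type (T * U)%type :=
  @Chart (V * W)%type (T * U)%type (chart_dom phi `*` chart_dom psi)
    (fun p => (phi p.1, psi p.2))
    (fun z => (chart_inv phi z.1, chart_inv psi z.2)) _ _ _ _ _.
Next Obligation. by move=> *; apply: open_setX; exact: chart_dom_open. Qed.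
Next Obligation.
by move=> *; rewrite image_prod; apply: open_setX; exact: chart_img_open.
Qed.
Next Obligation. by move=> T U phi psi [x y] [/= dx dy]; rewrite !chart_mapK. Qed.
Next Obligation.
move=> T U phi psi [x y] [/= dx dy]; apply: cvg_pair => /=.
  by apply: cvg_comp; [exact: cvg_fst | exact: chart_map_continuous].
by apply: cvg_comp; [exact: cvg_snd | exact: chart_map_continuous].
Qed.
Next Obligation.
move=> T U phi psi [a b]; rewrite image_prod => -[/= ia ib]; apply: cvg_pair => /=.
  by apply: cvg_comp; [exact: cvg_fst | exact: chart_inv_continuous].
by apply: cvg_comp; [exact: cvg_snd | exact: chart_inv_continuous].
Qed.

Program Definition prod_space (X : smooth_space V) (Y : smooth_space W) :
    smooth_space (V * W)%type :=
  @SmoothSpace (V * W)%type (X * Y)%type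
    [set chi | exists phi psi,
       [/\ atlas X phi, atlas Y psi & chi = prod_chart phi psi]]
    (fun p => prod_chart (chart_at p.1) (chart_at p.2)) _ _ _.
Next Obligation.
move=> X Y [x y]; exists (chart_at x), (chart_at y).
by split => //; exact: chart_at_atlas.
Qed.
Next Obligation. by move=> X Y [x y]; split; exact: chart_at_dom. Qed.
Next Obligation.
move=> X Y _ _ [phi [psi [aphi apsi ->]]] [phi' [psi' [aphi' apsi' ->]]] k.
have oI (V' : normedModType R) (T : topologicalType) (c c' : chart V' T) :
    open (c @` (chart_dom c `&` chart_dom c')).
  apply: chart_img_open_sub; last by move=> ? [].
  by apply: openI; exact: chart_dom_open.
rewrite /= -setXI image_prod.
exact: (Ck_prod (oI _ _ _ _) (oI _ _ _ _) (atlas_compat aphi aphi' k)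
                (atlas_compat apsi apsi' k)).
Qed.

End ProductSpace.
End Charts.

#[global] Arguments manifold R n : clear implicits.

Section SmoothMaps.
Context {R : realType} {V W : normedModType R}.
Variables (X : smooth_space V) (Y : smooth_space W).
Implicit Types (f : X -> Y) (x : X).

Definition smooth_at f x : Prop :=
  (\forall y \near x, {for y, continuous f}) /\
  exists U : set V, [/\ open U, U (chart_at x x) &
    Coo U (chart_at (f x) \o f \o chart_inv (chart_at x))].

Definition smooth f : Prop := forall x, smooth_at f x.

(* Smoothness of maps defined on a subset [S] of [X]: near each point of [S]
   they extend to smooth maps.  When [S] is an embedded submanifold this is
   smoothness for the induced manifold structure. *)
Definition local_extension (S : set X) f x : set (X -> Y) :=
  [set F | smooth_at F x /\ \forall y \near x, S y -> F y = f y].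

Definition smooth_within (S : set X) f x : Prop :=
  exists F, local_extension S f x F.

Definition smooth_on (S : set X) f : Prop :=
  forall x, S x -> smooth_within S f x.

End SmoothMaps.

Definition diffeomorphism (R : realType) (V W : normedModType R)
    (X : smooth_space V) (Y : smooth_space W) (f : X -> Y) : Prop :=
  smooth f /\ exists g : Y -> X, [/\ smooth g, cancel f g & cancel g f].

(* Tangent vectors at [x] are represented by their coordinates in [chart_at x]. *)
Definition tangent (R : realType) (V : normedModType R) (X : smooth_space V)
    (x : X) : normedModType R := V.

Section Differentials.
Context {R : realType} {V W : normedModType R}.
Variables (X : smooth_space V) (Y : smooth_space W).

Definition mdiff (f : X -> Y) (x : X) (v : tangent x) : tangent (f x) :=
  'D_v (chart_at (f x) \o f \o chart_inv (chart_at x)) (chart_at x x).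

(* The differential of a map defined on a submanifold [S]; it is meaningful for
   [v] tangent to [S], where it does not depend on the chosen extension. *)
Definition mdiff_within (S : set X) (f : X -> Y) (x : X) (v : tangent x) :
    tangent (f x) :=
  mdiff (xget f (local_extension S f x)) v.

Definition submersion (f : X -> Y) : Prop :=
  forall (x : X) (w : tangent (f x)), exists v : tangent x, mdiff f v = w.

Definition velocity (gamma : R -> X) (e : R) : tangent (gamma e) :=
  derive1 (chart_at (gamma e) \o gamma) e.

(* Coordinates of [v] in an arbitrary chart around [y]. *)
Definition tangent_coord (psi : chart W Y) (y : Y) (v : tangent y) : W :=
  'D_v (psi \o chart_inv (chart_at y)) (chart_at y y).

(* Smoothness of x |-> (b x, c x), as a map from [S] to the tangent bundle of
   [Y]. *)
Definition smooth_lift (S : set X) (b : X -> Y) (c : forall x, tangent (b x)) :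
    Prop :=
  smooth_on S b /\
  forall x0, S x0 ->
    smooth_within (Y := model_space W) S
      (fun x => tangent_coord (chart_at (b x0)) (c x)) x0.

End Differentials.

(* The product [mul g h] is meaningful only when [src g = tgt h]. *)
Record groupoid_maps (G M : Type) := GroupoidMaps {
  src : G -> M;
  tgt : G -> M;
  mul : G -> G -> G;
  unit_arrow : M -> G;
  inv : G -> G }.

Definition groupoid_eq (G M : Type) (A B : groupoid_maps G M) : Prop :=
  [/\ src A =1 src B, tgt A =1 tgt B,
      forall g h, src A g = tgt A h -> mul A g h = mul B g h,
      unit_arrow A =1 unit_arrow B & inv A =1 inv B].

Record is_groupoid (G M : Type) (A : groupoid_maps G M) : Prop := IsGroupoid {
  src_mul : forall g h, src A g = tgt A h -> src A (mul A g h) = src A h;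
  tgt_mul : forall g h, src A g = tgt A h -> tgt A (mul A g h) = tgt A g;
  mul_assoc : forall g h k, src A g = tgt A h -> src A h = tgt A k ->
    mul A (mul A g h) k = mul A g (mul A h k);
  src_unit : forall x, src A (unit_arrow A x) = x;
  tgt_unit : forall x, tgt A (unit_arrow A x) = x;
  mul_unitl : forall g, mul A (unit_arrow A (tgt A g)) g = g;
  mul_unitr : forall g, mul A g (unit_arrow A (src A g)) = g;
  src_inv : forall g, src A (inv A g) = tgt A g;
  tgt_inv : forall g, tgt A (inv A g) = src A g;
  mul_invl : forall g, mul A (inv A g) g = unit_arrow A (src A g);
  mul_invr : forall g, mul A g (inv A g) = unit_arrow A (tgt A g) }.

(* (p, q) |-> p q^-1, for p and q with the same source. *)
Definition divm (G M : Type) (A : groupoid_maps G M) (p q : G) : G :=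
  mul A p (inv A q).

Section LieGroupoids.
Context {R : realType} {n m : nat} {G : manifold R n} {M : manifold R m}.

Record is_lie_groupoid (A : groupoid_maps G M) : Prop := IsLieGroupoid {
  lie_is_groupoid : is_groupoid A;
  src_smooth : smooth (src A);
  src_submersion : submersion (src A);
  tgt_smooth : smooth (tgt A);
  tgt_submersion : submersion (tgt A);
  mul_smooth : smooth_on (X := prod_space G G)
    [set p | src A p.1 = tgt A p.2] (fun p => mul A p.1 p.2);
  unit_smooth : smooth (unit_arrow A);
  inv_smooth : smooth (inv A) }.

Definition lie_groupoid_iso (A B : groupoid_maps G M) (Phi : G -> G)
    (phi : M -> M) : Prop :=
  [/\ diffeomorphism Phi, diffeomorphism phi,
      forall g, src B (Phi g) = phi (src A g),
      forall g, tgt B (Phi g) = phi (tgt A g) &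
      forall g h, src A g = tgt A h -> Phi (mul A g h) = mul B (Phi g) (Phi h)].

Definition open_interval_at0 (I : set R) : Prop :=
  [/\ is_interval I, open I & I 0].

Local Notation line := (model_space R^o).

(* The values of the family outside [I] are irrelevant. *)
Record strict_deformation (A : groupoid_maps G M) (I : set R)
    (D : R -> groupoid_maps G M) : Prop := StrictDeformation {
  def_interval : open_interval_at0 I;
  def_lie_groupoid : forall e, I e -> is_lie_groupoid (D e);
  def_at0 : groupoid_eq (D 0) A;
  def_src_smooth : smooth_on (X := prod_space line G)
    [set p | I p.1] (fun p => src (D p.1) p.2);
  def_tgt_smooth : smooth_on (X := prod_space line G)
    [set p | I p.1] (fun p => tgt (D p.1) p.2);
  def_mul_smooth : smooth_on (X := prod_space line (prod_space G G))
    [set p | I p.1 /\ src (D p.1) p.2.1 = tgt (D p.1) p.2.2]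
    (fun p => mul (D p.1) p.2.1 p.2.2);
  def_unit_smooth : smooth_on (X := prod_space line M)
    [set p | I p.1] (fun p => unit_arrow (D p.1) p.2);
  def_inv_smooth : smooth_on (X := prod_space line G)
    [set p | I p.1] (fun p => inv (D p.1) p.2) }.

Definition s_constant (A : groupoid_maps G M) (I : set R)
    (D : R -> groupoid_maps G M) : Prop :=
  forall e, I e -> src (D e) =1 src A.

Definition equivalent_deformations (I : set R) (D : R -> groupoid_maps G M)
    (I' : set R) (D' : R -> groupoid_maps G M) : Prop :=
  exists (J : set R) (Phi : R -> G -> G) (phi : R -> M -> M),
    [/\ open_interval_at0 J, J `<=` I `&` I',
        smooth_on (X := prod_space line G) [set p | J p.1]
          (fun p => Phi p.1 p.2) /\
        smooth_on (X := prod_space line M) [set p | J p.1]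
          (fun p => phi p.1 p.2),
        forall e, J e -> lie_groupoid_iso (D e) (D' e) (Phi e) (phi e) &
        Phi 0 =1 id /\ phi 0 =1 id].

End LieGroupoids.

(* [gpow X k] is the (k+1)-fold product X * (X * (... * X)). *)
Fixpoint vpow (R : realType) (V : normedModType R) (k : nat) : normedModType R :=
  if k is k'.+1 then (V * vpow V k')%type : normedModType R else V.

Fixpoint gpow (R : realType) (V : normedModType R) (X : smooth_space V)
    (k : nat) : smooth_space (vpow V k) :=
  match k with
  | 0%N => X
  | k'.+1 => prod_space X (gpow X k')
  end.

Section Complex.
Context {R : realType} {n m : nat} {G : manifold R n} {M : manifold R m}.
Variable A : groupoid_maps G M.

Fixpoint first_arrow (k : nat) : gpow G k -> G :=
  match k with
  | 0%N => fun x => x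
  | _.+1 => fun x => x.1
  end.

Definition tail (k : nat) (x : gpow G k.+1) : gpow G k := x.2.

Fixpoint composable (k : nat) : set (gpow G k) :=
  match k with
  | 0%N => setT
  | _.+1 => fun x => src A x.1 = tgt A (first_arrow x.2) /\ composable x.2
  end.

(* [contract i] multiplies the arrows in positions i and i+1, counted from 0. *)
Fixpoint contract (k : nat) (i : nat) : gpow G k.+1 -> gpow G k :=
  match k with
  | 0%N => fun x => mul A x.1 x.2
  | k'.+1 => match i with
             | 0%N => fun x => (mul A x.1 x.2.1, x.2.2)
             | i'.+1 => fun x => (x.1, contract i' x.2)
             end
  end.

Fixpoint drop_last (k : nat) : gpow G k.+1 -> gpow G k :=
  match k with
  | 0%N => fun x => x.1
  | _.+1 => fun x => (x.1, drop_last x.2)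
  end.

(* The data on which s_c may depend: (g_2, ..., g_k) for k > 1 and, since the
   empty strings of arrows are the objects, s(g_1) for k = 1. *)
Definition same_tail (k : nat) : gpow G k -> gpow G k -> Prop :=
  match k with
  | 0%N => fun x y => src A x = src A y
  | _.+1 => fun x y => x.2 = y.2
  end.

(* Everything below indexes degree k+1 by [k]. *)
Definition cochain (k : nat) := forall x : gpow G k, tangent (first_arrow x).

(* The cochain group of degree k+1; only values on composable strings matter. *)
Definition is_cochain (k : nat) (c : cochain k) : Prop :=
  smooth_lift (@composable k) c /\
  forall x y, composable x -> composable y -> same_tail x y ->
    mdiff (src A) (c x) = mdiff (src A) (c y).

(* T(G x_s G) consists of the pairs (v, w) with ds v = ds w. *)
Definition diff_divm (p q : G) (v : tangent p) (w : tangent q) :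
    tangent (divm A p q) :=
  mdiff_within (X := prod_space G G) (x := (p, q))
    [set z | src A z.1 = src A z.2] (fun z => divm A z.1 z.2) (v, w).

Definition delta (k : nat) (c : cochain k) : cochain k.+1 := fun x =>
  - diff_divm (c (contract 0 x)) (c (tail x))
  + \sum_(1 <= i < k.+1) (-1) ^+ i.+1 *: c (contract i x)
  + (-1) ^+ k.+2 *: c (drop_last x).

Definition is_cocycle (k : nat) (c : cochain k) : Prop :=
  is_cochain c /\ forall x, composable x -> delta c x = 0.

(* The class of [c] in degree k+2: its coset modulo coboundaries. *)
Definition cohomology_class (k : nat) (c : cochain k.+1) : set (cochain k.+1) :=
  [set c' | is_cocycle c' /\
     exists b : cochain k, is_cochain b /\
       forall x, composable x -> c' x - c x = delta b x].

Definition xi0 (D : R -> groupoid_maps G M) : cochain 1 := fun x =>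
  velocity (fun e => divm (D e) (mul A x.1 x.2) x.2) 0.

End Complex.

(* Main.v *)
(* Differentiating the groupoid identity
     mbar_e (mbar_e (ghk, k), mbar_e (hk, k)) = mbar_e (ghk, hk)
   at e = 0 gives the cocycle equation for xi_0.  If Phi_e is an equivalence from
   (G_e) to (G'_e), then Phi_e (mbar_e (gh, h)) = mbar'_e (Phi_e (gh), Phi_e h);
   differentiating at e = 0 gives xi'_0 - xi_0 = delta X, where X is the velocity
   of Phi_e.  In both identities the variation of e and that of the arguments
   contribute separately to the derivative.  The vectors to which the differential
   of mbar is applied are velocities of explicit curves in the domain of mbar,
   which makes this differential independent of the local extension defining
   it, without any appeal to the implicit function theorem. *)
From HB Require Import structures.
From mathcomp Require Import all_boot all_order all_algebra.
From mathcomp Require Import all_classical all_reals all_analysis.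
(* [Defs] comes last because its [mul] clashes with that of [fraction]. *)
Require Import Defs.

Set Implicit Arguments.
Unset Strict Implicit.
Unset Printing Implicit Defensive.

Import Order.TTheory GRing.Theory Num.Theory numFieldNormedType.Exports.
Local Open Scope classical_set_scope.
Local Open Scope ring_scope.

(** * Calculus of smooth maps between normed spaces *)

Section Frames.
Context {R : realType}.

(* Finite dimensionality, with continuous coordinates.  It is what makes [Ck]
   stable under composition: [Ck] only controls each directional derivative
   separately, and 'D_(f'(x) v) g is a finite combination of those. *)
Definition framed (V : normedModType R) : Prop :=
  exists (J : finType) (e : J -> V) (c : J -> {linear V -> R^o}),
    (forall j, continuous (c j)) /\ forall v, v = \sum_j c j v *: e j.

Lemma framed_line : framed R^o.
Proof.
exists unit, (fun=> 1), (fun=> idfun); split=> [_|v].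
  by move=> x; exact: cvg_id.
by rewrite big_const card_unit /= addr0 [_ *: _]mulr1.
Qed.

Lemma framed_rV n : framed 'rV[R]_n.
Proof.
have lin j : linear (fun v : 'rV[R]_n => v ord0 j : R^o).
  by move=> a u v; rewrite !mxE.
pose c j : {linear 'rV[R]_n -> R^o} :=
  HB.pack (fun v : 'rV[R]_n => v ord0 j : R^o)
    (GRing.isLinear.Build _ _ _ _ _ (lin j)).
exists 'I_n, (fun j => delta_mx ord0 j), c; split=> [j|v].
  exact: coord_continuous.
by rewrite {1}(row_sum_delta v).
Qed.

Lemma framed_prod (V W : normedModType R) :
  framed V -> framed W -> framed (V * W)%type.
Proof.
move=> [J1 [e1 [c1 [cc1 E1]]]] [J2 [e2 [c2 [cc2 E2]]]].
pose c (j : J1 + J2) : {linear (V * W)%type -> R^o} :=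
  match j with inl i => c1 i \o @fst V W | inr i => c2 i \o @snd V W end.
exists (J1 + J2)%type,
  (fun j => match j with inl i => (e1 i, 0) | inr i => (0, e2 i) end), c.
split=> [j|v].
  case: j => i z /=; apply: cvg_comp;
    [exact: cvg_fst | exact: cc1 | exact: cvg_snd | exact: cc2].
rewrite big_sumType /=.
have -> : \sum_(i : J1) c1 i v.1 *: ((e1 i, 0) : V * W) = (v.1, 0).
  rewrite {2}(E1 v.1); elim/big_rec2: _ => // i y x _ ->.
  by congr pair; rewrite /= ?scaler0 ?addr0.
have -> : \sum_(i : J2) c2 i v.2 *: ((0, e2 i) : V * W) = (0, v.2).
  rewrite {2}(E2 v.2); elim/big_rec2: _ => // i y x _ ->.
  by congr pair; rewrite /= ?scaler0 ?addr0.
by case: v => a b; congr pair; rewrite /= ?addr0 ?add0r.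
Qed.

End Frames.

(** * Stability of C^k maps under algebraic operations and composition *)

Section CkCalculus.
Context {R : realType}.
Implicit Types V W Z : normedModType R.

Lemma Ck_sub V W k (A B : set V) (f : V -> W) : A `<=` B -> Ck k B f -> Ck k A f.
Proof.
move=> AB; elim: k f => [|k IHk] f /=; first by move=> cf x /AB; exact: cf.
by move=> [df Df]; split=> [x /AB|v]; [exact: df | exact: IHk].
Qed.

Lemma CkW V W k (A : set V) (f : V -> W) : Ck k.+1 A f -> Ck k A f.
Proof.
elim: k f => [|k IHk] f [df Df] /=.
  by move=> x /df; exact: differentiable_continuous.
by split=> // v; exact: IHk (Df v).
Qed.

Lemma Ck_cst V W k (A : set V) (w : W) : Ck k A (fun=> w).
Proof.
elim: k w => [|k IHk] w /=; first by move=> x _; exact: cvg_cst.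
split=> [x _|v]; first exact: differentiable_cst.
have -> : (fun x : V => 'D_v (fun=> w) x) = (fun=> 0).
  by apply: funext => x; exact: derive_cst.
exact: IHk.
Qed.

Lemma Ck_linear_comp V W Z k (A : set V) (L : {linear W -> Z}) (f : V -> W) :
  open A -> continuous L -> Ck k A f -> Ck k A (L \o f).
Proof.
move=> oA cL; have dL x : differentiable L x by exact: linear_differentiable.
elim: k f => [|k IHk] f /=.
  by move=> cf x Ax; apply: cvg_comp (cf x Ax) _; exact: cL.
move=> [df Df]; split=> [x Ax|v].
  by apply: differentiable_comp => //; exact: df.
apply: Ck_ext (IHk _ (Df v)) => // x Ax; have dfx := df x Ax.
rewrite /= (deriveE _ dfx) (deriveE _ (differentiable_comp dfx (dL _))).
by rewrite (diff_comp dfx (dL _)) /= diff_lin.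
Qed.

Lemma CkD V W k (A : set V) (f g : V -> W) :
  open A -> Ck k A f -> Ck k A g -> Ck k A (fun x => f x + g x).
Proof.
move=> oA; elim: k f g => [|k IHk] f g /=.
  by move=> cf cg x Ax; apply: (@cvgD _ W _ (nbhs x)); [exact: cf | exact: cg].
move=> [df Df] [dg Dg]; split=> [x Ax|v].
  by apply: differentiableD; [exact: df | exact: dg].
apply: Ck_ext (IHk _ _ (Df v) (Dg v)) => // x Ax.
by rewrite -deriveD //; apply: diff_derivable; [exact: df|exact: dg].
Qed.

(** Induction through the Leibniz rule; its terms contain [f] and [g] undifferentiated, whose order
    [CkW] lowers to that of the induction hypothesis. *)
Lemma CkM V k (A : set V) (f g : V -> R^o) :
  open A -> Ck k A f -> Ck k A g -> Ck k A (fun x => f x * g x : R^o).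
Proof.
move=> oA; elim: k f g => [|k IHk] f g.
  by move=> /= cf cg x Ax; apply: (@cvgM _ _ (nbhs x)); [exact: cf | exact: cg].
move=> fA gA; have [[df Df] [dg Dg]] := (fA, gA); split=> [x Ax|v].
  by apply: differentiableM; [exact: df | exact: dg].
apply: Ck_ext (CkD oA (IHk _ _ (CkW fA) (Dg v)) (IHk _ _ (CkW gA) (Df v)))
  => // x Ax.
by rewrite deriveM //; apply: diff_derivable; [exact: df|exact: dg].
Qed.

Lemma Ck_sum V W (J : finType) k (A : set V) (f : J -> V -> W) :
  open A -> (forall j, Ck k A (f j)) -> Ck k A (fun x => \sum_j f j x).
Proof.
move=> oA fA; elim: (index_enum J) => [|j s IHs].
  under eq_fun do rewrite big_nil; exact: Ck_cst.
by under eq_fun do rewrite big_cons; exact: CkD.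
Qed.

(** In frame coordinates the product is a finite sum of scalar functions times fixed vectors [e j],
    which reduces the claim to [CkM]. *)
Lemma Ck_scale V W k (A : set V) (a : V -> R^o) (f : V -> W) :
  framed W -> open A -> Ck k A a -> Ck k A f -> Ck k A (fun x => a x *: f x).
Proof.
move=> [J [e [c [cc E]]]] oA aA fA.
have -> : (fun x => a x *: f x) = (fun x => \sum_j (a x * c j (f x)) *: e j).
  apply: funext => x; rewrite {1}(E (f x)) scaler_sumr.
  by under eq_bigr do rewrite scalerA.
apply: Ck_sum => // j.
have cL : continuous ( *:%R^~ (e j) : R^o -> W) by exact: scalel_continuous.
have linL : linear ( *:%R^~ (e j) : R^o -> W).
  by move=> u y z; rewrite scalerDl scalerA.
pose L : {linear R^o -> W} :=
  HB.pack ( *:%R^~ (e j) : R^o -> W) (GRing.isLinear.Build _ _ _ _ _ linL).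
apply: (Ck_linear_comp (L := L) oA cL).
exact: CkM (aA) (Ck_linear_comp oA (cc j) fA).
Qed.

(** The chain rule expands ['D_v (g \o f) x] as the sum over j of
    [c j ('D_v f x) *: 'D_(e j) g (f x)]. The directions [e j] are fixed, so the induction
    hypothesis applies to each ['D_(e j) g \o f]. *)
Lemma Ck_comp V W Z k (A : set V) (B : set W) (f : V -> W) (g : W -> Z) :
  framed W -> framed Z -> open A -> (forall x, A x -> B (f x)) ->
  Ck k A f -> Ck k B g -> Ck k A (g \o f).
Proof.
move=> fW fZ oA AB; have [J [e [c [cc E]]]] := fW.
elim: k f g AB => [|k IHk] f g AB.
  by move=> fA gB x Ax; apply: cvg_comp (fA x Ax) _; exact: gB _ (AB x Ax).
move=> fA gB; have [[df Df] [dg Dg]] := (fA, gB); split=> [x Ax|v].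
  by apply: differentiable_comp; [exact: df | exact: dg _ (AB x Ax)].
have h j : Ck k A (fun x => c j ('D_v f x) *: 'D_(e j) g (f x)).
  apply: Ck_scale => //; first exact: Ck_linear_comp oA (cc j) (Df v).
  exact: IHk (AB) (CkW fA) (Dg (e j)).
apply: Ck_ext (Ck_sum oA h) => // x Ax.
have dfx := df x Ax; have dgx := dg _ (AB x Ax).
rewrite [RHS](deriveE _ (differentiable_comp dfx dgx)).
rewrite (diff_comp dfx dgx) /= -(deriveE v dfx) {2}(E ('D_v f x)) linear_sum.
by apply: eq_bigr => j _; rewrite linearZ (deriveE (e j) dgx).
Qed.

Lemma Ck_pair V W Z k (A : set V) (f : V -> W) (g : V -> Z) :
  open A -> Ck k A f -> Ck k A g -> Ck k A (fun x => (f x, g x)).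
Proof.
move=> oA; elim: k f g => [|k IHk] f g /=.
  by move=> cf cg x Ax; apply: cvg_pair; [exact: cf | exact: cg].
move=> [df Df] [dg Dg]; split=> [x Ax|v].
  by apply: differentiable_pair; [exact: df|exact: dg].
apply: Ck_ext (IHk _ _ (Df v) (Dg v)) => // x Ax.
have dfx := df x Ax; have dgx := dg x Ax.
rewrite (deriveE _ dfx) (deriveE _ dgx) (deriveE _ (differentiable_pair dfx dgx)).
by rewrite (diff_pair dfx dgx).
Qed.

End CkCalculus.

(** * Germs of smooth maps between normed spaces *)

Section CooNear.
Context {R : realType}.
Implicit Types V W Z : normedModType R.

(** One neighbourhood must serve for all orders of differentiability. *)
Definition Coo_near V W (f : V -> W) (z : V) : Prop :=
  exists U : set V, [/\ open U, U z & Coo U f].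

Lemma Coo_near_ext V W (f g : V -> W) z :
  {near z, f =1 g} -> Coo_near f z -> Coo_near g z.
Proof.
move=> fg [U [oU Uz fU]].
have : nbhs z (U `&` [set y | f y = g y]).
  by apply: filterI; [exact: open_nbhs_nbhs | exact: fg].
rewrite nbhsE => -[B [oB Bz] BU]; exists B; split=> // k.
apply: Ck_ext (Ck_sub _ (fU k)) => // y /BU; by case.
Qed.

Lemma Coo_near_near V W (f : V -> W) z :
  Coo_near f z -> \forall y \near z, Coo_near f y.
Proof.
move=> [U [oU Uz fU]]; have := open_nbhs_nbhs (conj oU Uz).
by apply: filterS => y Uy; exists U.
Qed.

Lemma Coo_near_differentiable V W (f : V -> W) z :
  Coo_near f z -> differentiable f z.
Proof. by move=> [U [_ Uz /(_ 1%N) [df _]]]; exact: df. Qed.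

Lemma Coo_near_derive V W (f : V -> W) z v :
  Coo_near f z -> Coo_near (fun y => 'D_v f y) z.
Proof.
move=> [U [oU Uz fU]]; exists U; split=> // k.
by have [_ DfU] := fU k.+1; exact: DfU.
Qed.

Lemma Coo_near_comp V W Z (fW : framed W) (fZ : framed Z)
    (f : V -> W) (g : W -> Z) z :
  Coo_near f z -> Coo_near g (f z) -> Coo_near (g \o f) z.
Proof.
move=> [U [oU Uz fU]] [U' [oU' Uz' gU]].
have cf : {for z, continuous f} by exact: (fU 0%N).
have : nbhs z (U `&` f @^-1` U').
  apply: filterI; first exact: open_nbhs_nbhs.
  by apply: cf; exact: open_nbhs_nbhs.
rewrite nbhsE => -[B [oB Bz] BU]; exists B; split=> // k.
apply: (@Ck_comp _ _ _ _ k B U' f g fW fZ oB _ _ (gU k)).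
  by move=> y /BU [].
by apply: Ck_sub (fU k) => y /BU [].
Qed.

Lemma Coo_near_pair V W Z (f : V -> W) (g : V -> Z) z :
  Coo_near f z -> Coo_near g z -> Coo_near (fun y => (f y, g y)) z.
Proof.
move=> [U [oU Uz fU]] [U' [oU' Uz' gU]]; exists (U `&` U'); split=> //.
  exact: openI.
move=> k; apply: Ck_pair; first exact: openI.
  by apply: Ck_sub (fU k) => y [].
by apply: Ck_sub (gU k) => y [].
Qed.

Lemma Coo_near_cst V W (w : W) (z : V) : Coo_near (fun=> w) z.
Proof. by exists setT; split=> // [|k]; [exact: openT | exact: Ck_cst]. Qed.

Lemma Coo_near_id V (z : V) : Coo_near id z.
Proof. by exists setT; split=> // [|k]; [exact: openT | exact: Ck_id]. Qed.

Lemma Coo_near_linear V W (L : {linear V -> W}) z : continuous L -> Coo_near L z.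
Proof.
move=> cL; exists setT; split=> //; first exact: openT.
move=> k; exact: (Ck_linear_comp openT cL (@Ck_id _ _ k setT)).
Qed.

Lemma Coo_nearD V W (f g : V -> W) z :
  Coo_near f z -> Coo_near g z -> Coo_near (fun y => f y + g y) z.
Proof.
move=> [U [oU Uz fU]] [U' [oU' Uz' gU]]; exists (U `&` U'); split=> //.
  exact: openI.
move=> k; apply: CkD; first exact: openI.
  by apply: Ck_sub (fU k) => y [].
by apply: Ck_sub (gU k) => y [].
Qed.

End CooNear.

(** * Smooth maps between manifolds *)

Section SmoothAt.
Context {R : realType}.
Implicit Types V W Z : normedModType R.

Lemma near_chart V (T : topologicalType) (phi : chart V T) x (P : set V) :
  chart_dom phi x -> (\forall z \near phi x, P z) -> \forall y \near x, P (phi y).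
Proof. by move=> dx; exact: chart_map_continuous dx P. Qed.

Lemma near_chart_inv V (T : topologicalType) (phi : chart V T) x (P : set T) :
  chart_dom phi x -> (\forall y \near x, P y) ->
  \forall z \near phi x, P (chart_inv phi z).
Proof.
move=> dx xP; have ix : (phi @` chart_dom phi) (phi x) by exists x.
by apply: (chart_inv_continuous ix); rewrite chart_mapK.
Qed.

Lemma near_chart_dom V (T : topologicalType) (phi : chart V T) x :
  chart_dom phi x -> \forall y \near x, chart_dom phi y.
Proof. by move=> dx; apply: open_nbhs_nbhs; split => //; exact: chart_dom_open. Qed.

Lemma Coo_near_transition V (X : smooth_space V) (phi psi : chart V X) x :
  atlas X phi -> atlas X psi -> chart_dom phi x -> chart_dom psi x ->
  Coo_near (psi \o chart_inv phi) (phi x).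
Proof.
move=> aphi apsi dx dx'; exists (phi @` (chart_dom phi `&` chart_dom psi)); split.
- apply: chart_img_open_sub; last by move=> ? [].
  by apply: openI; exact: chart_dom_open.
- by exists x.
- exact: atlas_compat.
Qed.

(** Transition maps turn one coordinate expression into the other. The identity holds only near
    [phi' x], where the charts are meaningful; continuity of [f] keeps [f y] in the domain of
    [psi]. *)
Lemma Coo_near_change V W (X : smooth_space V) (Y : smooth_space W)
    (phi phi' : chart V X) (psi psi' : chart W Y) (f : X -> Y) x :
  framed V -> framed W ->
  atlas X phi -> atlas X phi' -> atlas Y psi -> atlas Y psi' ->
  chart_dom phi x -> chart_dom phi' x ->
  chart_dom psi (f x) -> chart_dom psi' (f x) -> {for x, continuous f} ->
  Coo_near (psi \o f \o chart_inv phi) (phi x) ->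
  Coo_near (psi' \o f \o chart_inv phi') (phi' x).
Proof.
move=> fV fW ap ap' aq aq' dp dp' dq dq' cf fx.
have E : {near phi' x, (psi' \o chart_inv psi) \o
    ((psi \o f \o chart_inv phi) \o (phi \o chart_inv phi')) =1
    psi' \o f \o chart_inv phi'}.
  have : \forall y \near x, chart_dom phi y /\ chart_dom psi (f y).
    apply: filterI; first exact: near_chart_dom.
    by apply: cf; exact: near_chart_dom.
  move/(near_chart_inv dp'); apply: filterS => z [dz dfz].
  by rewrite /= (chart_mapK dz) (chart_mapK dfz).
apply: Coo_near_ext E _; apply: Coo_near_comp => //=.
  apply: Coo_near_comp => //=; first exact: Coo_near_transition.
  by rewrite chart_mapK.
by rewrite (chart_mapK dp') (chart_mapK dp); exact: Coo_near_transition.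
Qed.

Section At.
Context {V W : normedModType R} {X : smooth_space V} {Y : smooth_space W}.
Implicit Types (f g : X -> Y) (x : X).

Lemma smooth_at_near_continuous f x :
  smooth_at f x -> \forall y \near x, {for y, continuous f}.
Proof. by case. Qed.

Lemma smooth_at_continuous f x : smooth_at f x -> {for x, continuous f}.
Proof. by case=> /nbhs_singleton. Qed.

Lemma smooth_at_coo f x : smooth_at f x ->
  Coo_near (chart_at (f x) \o f \o chart_inv (chart_at x)) (chart_at x x).
Proof. by case. Qed.

Lemma smooth_at_coo_chart f x (psi : chart W Y) :
  framed V -> framed W -> atlas Y psi -> chart_dom psi (f x) -> smooth_at f x ->
  Coo_near (psi \o f \o chart_inv (chart_at x)) (chart_at x x).
Proof.
move=> fV fW apsi dpsi sf; apply: Coo_near_change (smooth_at_coo sf) => //;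
  try exact: chart_at_atlas; try exact: chart_at_dom.
exact: smooth_at_continuous.
Qed.

Lemma smooth_at_ext f g x : {near x, f =1 g} -> smooth_at f x -> smooth_at g x.
Proof.
move=> fg [cf fx]; split.
  have := nbhs_interior fg; apply: filterS2 cf => y cfy.
  move=> fgy; rewrite /prop_for /continuous_at.
  have <- : f y = g y by exact: nbhs_singleton fgy.
  by apply: cvg_trans cfy; exact: near_eq_cvg.
have E : {near chart_at x x, chart_at (f x) \o f \o chart_inv (chart_at x) =1
          chart_at (g x) \o g \o chart_inv (chart_at x)}.
  rewrite -(nbhs_singleton fg).
  have := near_chart_inv (chart_at_dom x) fg.
  by apply: filterS => z /= ->.
exact: Coo_near_ext E fx.
Qed.

Lemma smooth_at_cst (y : Y) x : smooth_at (fun=> y) x.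
Proof.
split; last exact: Coo_near_cst.
by near=> z; exact: cvg_cst.
Unshelve. all: by end_near. Qed.

End At.

Lemma smooth_at_id V (X : smooth_space V) (x : X) : smooth_at (@id X) x.
Proof.
split; first by near=> z; exact: cvg_id.
suff E : {near chart_at x x, id =1 chart_at x \o id \o chart_inv (chart_at x)}.
  exact: Coo_near_ext E (Coo_near_id _).
have dx := chart_at_dom x.
have : (chart_at x @` chart_dom (chart_at x)) (chart_at x x) by exists x.
move=> /(conj (chart_img_open (chart_at x))) /open_nbhs_nbhs.
by apply: filterS => _ [y dy <-]; rewrite /= chart_mapK.
Unshelve. all: by end_near. Qed.

(** The coordinate expressions of [f] and [g] use the same chart at [f x], which cancels near
    [x]. *)
Lemma smooth_at_comp V W Z (X : smooth_space V) (Y : smooth_space W)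
    (T : smooth_space Z) (f : X -> Y) (g : Y -> T) x :
  framed W -> framed Z ->
  smooth_at f x -> smooth_at g (f x) -> smooth_at (g \o f) x.
Proof.
move=> fW fZ sf sg; have cf := smooth_at_continuous sf; split.
  have := cf _ (smooth_at_near_continuous sg).
  apply: filterS2 (smooth_at_near_continuous sf) => y cfy cgy.
  exact: continuous_comp.
have E : {near chart_at x x, (chart_at (g (f x)) \o g \o chart_inv (chart_at (f x)))
     \o (chart_at (f x) \o f \o chart_inv (chart_at x)) =1
     chart_at (g (f x)) \o (g \o f) \o chart_inv (chart_at x)}.
  have := cf _ (near_chart_dom (chart_at_dom (f x))).
  move/(near_chart_inv (chart_at_dom x)); apply: filterS => z /= dz.
  by rewrite chart_mapK.
apply: Coo_near_ext E _; apply: Coo_near_comp => //=; first exact: smooth_at_coo.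
by rewrite (chart_mapK (chart_at_dom x)); exact: smooth_at_coo.
Qed.

Lemma smooth_at_pair V W Z (X : smooth_space V) (Y : smooth_space W)
    (T : smooth_space Z) (f : X -> Y) (g : X -> T) x :
  smooth_at f x -> smooth_at g x ->
  smooth_at (Y := prod_space Y T) (fun y => (f y, g y)) x.
Proof.
move=> sf sg; split.
  apply: filterS2 (smooth_at_near_continuous sf) (smooth_at_near_continuous sg).
  by move=> y cf cg; apply: cvg_pair.
exact: Coo_near_pair (smooth_at_coo sf) (smooth_at_coo sg).
Qed.

(** The chosen charts of a product are product charts, so in coordinates this is the linear
    projection followed by the expression of the identity. *)
Lemma smooth_at_fst V W (X : smooth_space V) (Y : smooth_space W) (p : X * Y) :
  framed V -> smooth_at (X := prod_space X Y) fst p.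
Proof.
move=> fV; split; first by near=> z; exact: cvg_fst.
have cf : Coo_near (@fst V W) (chart_at (s := prod_space X Y) p p).
  by apply: Coo_near_linear => z; exact: cvg_fst.
exact: Coo_near_comp cf (smooth_at_coo (@smooth_at_id V X p.1)).
Unshelve. all: by end_near. Qed.

Lemma smooth_at_snd V W (X : smooth_space V) (Y : smooth_space W) (p : X * Y) :
  framed W -> smooth_at (X := prod_space X Y) snd p.
Proof.
move=> fW; split; first by near=> z; exact: cvg_snd.
have cf : Coo_near (@snd V W) (chart_at (s := prod_space X Y) p p).
  by apply: Coo_near_linear => z; exact: cvg_snd.
exact: Coo_near_comp cf (smooth_at_coo (@smooth_at_id W Y p.2)).
Unshelve. all: by end_near. Qed.

Lemma smooth_at_chart V (X : smooth_space V) (x : X) :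
  smooth_at (Y := model_space V) (chart_at x) x.
Proof.
split; last exact: smooth_at_coo (@smooth_at_id V X x).
apply: filterS (near_chart_dom (chart_at_dom x)) => y.
exact: chart_map_continuous.
Qed.

Lemma Coo_near_smooth_at V W (f : V -> W) z :
  Coo_near f z -> smooth_at (X := model_space V) (Y := model_space W) f z.
Proof.
move=> fz; split=> //; apply: filterS (Coo_near_near fz) => y fy.
exact: differentiable_continuous (Coo_near_differentiable fy).
Qed.

End SmoothAt.

(** * Maps that are smooth on a subset *)

Section SmoothWithin.
Context {R : realType}.
Implicit Types V W Z : normedModType R.

Section Within.
Context {V W : normedModType R} {X : smooth_space V} {Y : smooth_space W}.
Implicit Types (S T : set X) (f g : X -> Y) (x : X).

Lemma smooth_at_within S f x : smooth_at f x -> smooth_within S f x.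
Proof. by move=> sf; exists f; split=> //; near=> y. Unshelve. all: by end_near. Qed.

Lemma smooth_within_sub S T f x :
  S `<=` T -> smooth_within T f x -> smooth_within S f x.
Proof.
by move=> ST [F [sF Ff]]; exists F; split=> //; apply: filterS Ff => y FS /ST.
Qed.

(** A local extension then has the germ of [f]. This turns smoothness over a parameter interval into
    smoothness of curves at 0. *)
Lemma smooth_within_nbhs S f x : nbhs x S -> smooth_within S f x -> smooth_at f x.
Proof.
move=> xS [F [sF Ff]]; apply: smooth_at_ext sF.
by apply: filterS2 xS Ff => y Sy; exact.
Qed.

End Within.

Lemma smooth_within_comp V W Z (X : smooth_space V) (Y : smooth_space W)
    (T : smooth_space Z) (S : set X) (S' : set Y) (f : X -> Y) (g : Y -> T) x :
  framed W -> framed Z -> S x -> (forall y, S y -> S' (f y)) ->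
  smooth_within S f x -> smooth_within S' g (f x) -> smooth_within S (g \o f) x.
Proof.
move=> fW fZ Sx SS' [F [sF Ff]] [K [sK Kg]].
have Fx : F x = f x by exact: nbhs_singleton Ff Sx.
rewrite -Fx in sK Kg; exists (K \o F); split; first exact: smooth_at_comp.
have := smooth_at_continuous sF Kg; apply: filterS2 Ff => y FS KS Sy.
by have Fy := FS Sy; rewrite /= KS Fy //; exact: SS'.
Qed.

Lemma smooth_within_pair V W Z (X : smooth_space V) (Y : smooth_space W)
    (T : smooth_space Z) (S : set X) (f : X -> Y) (g : X -> T) x :
  smooth_within S f x -> smooth_within S g x ->
  smooth_within (Y := prod_space Y T) S (fun y => (f y, g y)) x.
Proof.
move=> [F [sF Ff]] [K [sK Kg]]; exists (fun y => (F y, K y)).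
split; first exact: smooth_at_pair.
by apply: filterS2 Ff Kg => y FS KS Sy; rewrite FS // KS.
Qed.

End SmoothWithin.

(** * Velocities of curves *)

Section Velocities.
Context {R : realType}.
Implicit Types V W Z : normedModType R.
Local Notation line := (model_space R^o).

Section Mdiff.
Context {V W : normedModType R} {X : smooth_space V} {Y : smooth_space W}.
Implicit Types (f g : X -> Y) (x : X).

Lemma mdiff_linear f x (a : R) (v w : tangent x) : smooth_at f x ->
  mdiff f (v + a *: w) = mdiff f v + a *: mdiff f w.
Proof.
move=> /smooth_at_coo /Coo_near_differentiable df.
by rewrite /mdiff !(deriveE _ df) linearD linearZ.
Qed.

Lemma mdiffD f x (v w : tangent x) : smooth_at f x ->
  mdiff f (v + w) = mdiff f v + mdiff f w.
Proof. by move=> sf; rewrite -[w]scale1r mdiff_linear // !scale1r. Qed.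

Lemma velocity_ext (c c' : R -> X) e :
  {near e, c =1 c'} -> velocity c e = velocity c' e.
Proof.
(* The chart used by [velocity] depends on the base point, so [c e] is replaced by [c' e] first. *)
move=> cc'; rewrite /velocity (nbhs_singleton cc') !derive1E.
by apply: near_eq_derive; apply: filterS cc' => t /= ->.
Qed.

Lemma curve_differentiable (c : line -> X) e (psi : chart V X) :
  framed V -> atlas X psi -> chart_dom psi (c e) -> smooth_at c e ->
  differentiable (psi \o c : R^o -> V) e.
Proof.
move=> fV apsi dpsi sc; apply: Coo_near_differentiable.
exact: (smooth_at_coo_chart (framed_line (R := R)) fV apsi dpsi sc).
Qed.

Lemma velocity_comp (c : line -> X) f e :
  framed V -> smooth_at c e -> smooth_at f (c e) ->
  velocity (f \o c) e = mdiff f (velocity c e).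
Proof.
move=> fV sc sf.
have dc := curve_differentiable fV (chart_at_atlas _) (chart_at_dom _) sc.
have df := Coo_near_differentiable (smooth_at_coo sf).
rewrite /mdiff /velocity !derive1E.
(* The chart at [c e] is inserted between [f] and [c], which changes nothing while [c t] stays in
   its domain. *)
have -> : 'D_1 (chart_at (f (c e)) \o (f \o c)) e =
    'D_1 ((chart_at (f (c e)) \o f \o chart_inv (chart_at (c e))) \o
      (chart_at (c e) \o c)) e.
  have nd : \forall t \near e, chart_dom (chart_at (c e)) (c t).
    exact: smooth_at_continuous sc _ (near_chart_dom (chart_at_dom (c e))).
  by apply: near_eq_derive; apply: filterS nd => t /= dt; rewrite chart_mapK.
rewrite (deriveE _ (differentiable_comp dc df)) (diff_comp dc df) /=.
by rewrite -(deriveE _ dc) -(deriveE _ df).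
Qed.

(** Chain rule for the transition map between [psi] and the chart at [c e]. It allows a family of
    curves with varying base points to be read in one fixed chart. *)
Lemma tangent_coord_velocity (c : R -> X) e (psi : chart V X) :
  framed V -> atlas X psi -> chart_dom psi (c e) -> {for e, continuous c} ->
  differentiable (psi \o c : R^o -> V) e ->
  tangent_coord psi (velocity c e) = derive1 (psi \o c) e.
Proof.
move=> fV apsi dpsi cc dpc; rewrite /tangent_coord /velocity !derive1E.
have ac := chart_at_atlas (c e); have dx := chart_at_dom (c e).
have d1 := Coo_near_differentiable (Coo_near_transition apsi ac dpsi dx).
have d2 := Coo_near_differentiable (Coo_near_transition ac apsi dx dpsi).
have ncd : \forall t \near e, chart_dom (chart_at (c e)) (c t).
  exact: cc _ (near_chart_dom dx).
have ncp : \forall t \near e, chart_dom psi (c t) by exact: cc _ (near_chart_dom dpsi).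
have dc : differentiable (chart_at (c e) \o c : R^o -> V) e.
  apply: (near_eq_differentiable _ (differentiable_comp dpc d1)).
  by apply: filterS ncp => t /= dt; rewrite chart_mapK.
rewrite (deriveE _ d2) (deriveE _ dc).
have -> : 'D_1 (psi \o c) e =
    'D_1 ((psi \o chart_inv (chart_at (c e))) \o (chart_at (c e) \o c)) e.
  by apply: near_eq_derive; apply: filterS ncd => t /= dt; rewrite chart_mapK.
by rewrite (deriveE _ (differentiable_comp dc d2)) (diff_comp dc d2).
Qed.

Lemma velocity_cst (x : X) e : velocity (fun=> x) e = 0.
Proof. by rewrite /velocity derive1_cst. Qed.

End Mdiff.

Lemma velocity_pair V W (X : smooth_space V) (Y : smooth_space W)
    (c : line -> X) (c' : line -> Y) e :
  framed V -> framed W -> smooth_at c e -> smooth_at c' e ->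
  velocity (X := prod_space X Y) (fun t => (c t, c' t)) e =
  (velocity c e, velocity c' e).
Proof.
move=> fV fW sc sc'.
have d1 := curve_differentiable fV (chart_at_atlas _) (chart_at_dom _) sc.
have d2 := curve_differentiable fW (chart_at_atlas _) (chart_at_dom _) sc'.
rewrite /velocity !derive1E (deriveE _ d1) (deriveE _ d2).
by rewrite [LHS](deriveE _ (differentiable_pair d1 d2)) (diff_pair d1 d2).
Qed.

Lemma near_section (T U : topologicalType) (a : T) (x : U) (P : set (T * U)) :
  (\forall p \near (a, x), P p) ->
  \forall y \near x, \forall t \near a, P (t, y).
Proof.
case=> -[A B] [/= nA nB] AB; apply: filterS nB => y By.
by apply: filterS nA => t At; exact: (AB (t, y)).
Qed.

(** In a fixed chart around [b x0], the velocity at [x] is the time derivative at 0 of the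
    coordinate expression [K] of a local extension of [f]. A directional derivative of a smooth map
    is smooth, so it varies smoothly with [x]. *)
Lemma smooth_lift_velocity V W (X : smooth_space V) (Y : smooth_space W)
    (I : set R) (S : set X) (f : R -> X -> Y) (b : X -> Y) :
  framed V -> framed W -> nbhs 0 I -> (forall x, S x -> f 0 x = b x) ->
  smooth_on (X := prod_space line X) (I `*` S) (fun p => f p.1 p.2) ->
  smooth_on S b ->
  smooth_lift S (b := b) (fun x => velocity (f ^~ x) 0).
Proof.
move=> fV fW I0 fb sf sb; split=> // x0 Sx0.
have Sp0 : (I `*` S) (0, x0) by split => //; exact: nbhs_singleton.
have [H [sH Hf]] := sf (0, x0) Sp0.
have H0 : H (0, x0) = b x0 by rewrite (nbhs_singleton Hf Sp0) /= fb.
have dpsi := chart_at_dom (b x0); have dx0 := chart_at_dom x0.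
pose K : R^o * V -> W := chart_at (b x0) \o H \o
  chart_inv (chart_at (s := prod_space line X) (0, x0)).
have cK : Coo_near K ((0, chart_at x0 x0) : R^o * V).
  by move: (smooth_at_coo sH); rewrite H0.
have csec (z : V) : {for z, continuous (fun z : V => ((0, z) : R^o * V))}.
  apply: (@cvg_pair _ _ _ (nbhs z) (nbhs (0 : R^o)) (nbhs z)).
    exact: cvg_cst.
  exact: cvg_id.
(* The required extension is the derivative of [K] in the pure time direction, at time 0. *)
exists (fun x => 'D_((1, 0) : R^o * V) K (0, chart_at x0 x)); split.
  apply: (@smooth_at_comp _ _ _ _ _ (model_space V) (model_space W) (chart_at x0)
    (fun z : V => 'D_((1, 0) : R^o * V) K (0, z))) => //.
    exact: smooth_at_chart.
  apply: Coo_near_smooth_at.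
  apply: (Coo_near_comp (framed_prod (framed_line (R := R)) fV) fW
    (f := fun z : V => ((0, z) : R^o * V)) (g := fun p => 'D_((1, 0) : R^o * V) K p)).
    exact: Coo_near_pair (Coo_near_cst _ _) (Coo_near_id _).
  exact: Coo_near_derive.
(* [n1] to [n5] hold for [x] near [x0] and small times: the charts are meaningful, [K] is smooth,
   and [H] is continuous and extends [f]. *)
have n1 := near_chart_dom dx0.
have n2 : \forall x \near x0, Coo_near K ((0, chart_at x0 x) : R^o * V).
  exact: near_chart dx0 (csec _ _ (Coo_near_near cK)).
have n3 := near_section (smooth_at_near_continuous sH).
have n4 := near_section Hf.
have n5 : \forall x \near x0, \forall t \near 0, chart_dom (chart_at (b x0)) (H (t, x)).
  apply: (near_section (P := fun p => chart_dom (chart_at (b x0)) (H p))).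
  have ndH : nbhs (H (0, x0)) (chart_dom (chart_at (b x0))).
    by rewrite H0; exact: near_chart_dom.
  exact: smooth_at_continuous sH _ ndH.
near=> x => Sx.
have dx : chart_dom (chart_at x0) x by near: x.
have cKx : Coo_near K ((0, chart_at x0 x) : R^o * V) by near: x.
have ncH : \forall t \near (0 : R^o), {for (t, x), continuous H} by near: x.
have cH : {for (0, x), continuous H} := nbhs_singleton ncH.
have Hfx : \forall t \near 0, (I `*` S) (t, x) -> H (t, x) = f t x by near: x.
have ndH : \forall t \near (0 : R^o), chart_dom (chart_at (b x0)) (H (t, x)).
  by near: x.
have dH : chart_dom (chart_at (b x0)) (H (0, x)) := nbhs_singleton ndH.
pose c : R^o -> Y := fun t => H (t, x).
have cf : {near 0, f ^~ x =1 c}.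
  apply: filterS2 I0 Hfx => t It Htx; by rewrite /c Htx.
have c0 : c 0 = b x by rewrite -(nbhs_singleton cf) fb.
have cc : {for 0, continuous c}.
  apply: (@cvg_comp _ _ _ (fun t : R^o => (t, x)) H _ _ _ _ cH).
  apply: (@cvg_pair _ _ _ (nbhs (0 : R^o)) (nbhs (0 : R^o)) (nbhs x)).
    exact: cvg_id.
  exact: cvg_cst.
(* In charts the slice curve is [K] along a line in the time direction. *)
have Kc : chart_at (b x0) \o c = K \o (fun t : R^o => (t, chart_at x0 x)).
  by apply: funext => t; rewrite /K /= chart_mapK.
have ds : is_diff (0 : R^o) (fun t : R^o => ((t, chart_at x0 x) : R^o * V))
    (fun t => (t, 0)).
  exact: is_diff_pair (is_diff_id _) (is_diff_cst _ _).
have dK := Coo_near_differentiable cKx.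
have dc : differentiable (chart_at (b x0) \o c : R^o -> W) 0.
  by rewrite Kc; apply: differentiable_comp.
have -> : tangent_coord (chart_at (b x0)) (y := b x) (velocity (f ^~ x) 0) =
    tangent_coord (chart_at (b x0)) (velocity c 0).
  by rewrite -c0 (velocity_ext cf).
rewrite (tangent_coord_velocity fW (chart_at_atlas _) dH cc dc) derive1E.
rewrite (deriveE _ dc) (deriveE _ dK) Kc.
rewrite (diff_comp (ex_diff (is_diff_def := ds)) dK) /=.
by rewrite (diff_val (is_diff_def := ds)).
Unshelve. all: by end_near. Qed.

End Velocities.

(** * Partial velocities of a map depending on time *)

Section PartialVelocities.
Context {R : realType}.
Local Notation line := (model_space R^o).

Lemma smooth_at_curve_pair (V : normedModType R) (X : smooth_space V)
    (c : line -> X) e :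
  smooth_at c e -> smooth_at (Y := prod_space line X) (fun t => (t, c t)) e.
Proof. by move=> sc; apply: smooth_at_pair => //; exact: smooth_at_id. Qed.

(** The velocity of [(t, c t)] is the sum of those of [(t, c e)] and [(e, c t)], and the
    differential of [F] is additive. *)
Lemma velocity_split (V W : normedModType R) (X : smooth_space V)
    (Y : smooth_space W) (F : prod_space line X -> Y) (c : line -> X) e :
  framed V -> framed W -> smooth_at c e -> smooth_at F (e, c e) ->
  velocity (fun t => F (t, c t)) e =
  velocity (fun t => F (t, c e)) e + velocity (fun t => F (e, c t)) e.
Proof.
move=> fV fW sc sF.
have fRV := framed_prod (framed_line (R := R)) fV.
have sid : smooth_at (X := line) (Y := line) id e by exact: smooth_at_id.
have sce : smooth_at (X := line) (fun=> e : line) e by exact: smooth_at_cst.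
have scx : smooth_at (X := line) (fun=> c e) e by exact: smooth_at_cst.
have s1 := smooth_at_pair sid sc; have s2 := smooth_at_pair sid scx.
have s3 := smooth_at_pair sce sc.
rewrite [LHS](velocity_comp (X := prod_space line X)
  (c := fun t : line => (t, c t)) (f := F) fRV s1 sF).
rewrite [X in _ = X + _](velocity_comp (X := prod_space line X)
  (c := fun t : line => (t, c e)) (f := F) fRV s2 sF).
rewrite [X in _ = _ + X](velocity_comp (X := prod_space line X)
  (c := fun t : line => (e, c t)) (f := F) fRV s3 sF).
rewrite -[RHS]mdiffD //; congr mdiff.
rewrite (velocity_pair (framed_line (R := R)) fV sid sc).
rewrite (velocity_pair (framed_line (R := R)) fV sid scx).
rewrite (velocity_pair (framed_line (R := R)) fV sce sc).
by rewrite !velocity_cst; congr pair; rewrite ?addr0 ?add0r.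
Qed.

End PartialVelocities.

(** * Division maps *)

Section GroupoidAlgebra.
Context {G M : Type} {B : groupoid_maps G M} (gB : is_groupoid B).

Lemma src_divm p q : src B p = src B q -> src B (divm B p q) = tgt B q.
Proof. by move=> pq; rewrite /divm (src_mul gB) ?(src_inv gB) // (tgt_inv gB). Qed.

Lemma mul_invKr g h : src B g = tgt B h -> divm B (mul B g h) h = g.
Proof.
move=> gh; rewrite /divm (mul_assoc gB) // ?(tgt_inv gB) //.
by rewrite (mul_invr gB) -gh (mul_unitr gB).
Qed.

Lemma divm_mulK p q : src B p = src B q -> mul B (divm B p q) q = p.
Proof.
move=> pq; rewrite /divm (mul_assoc gB) ?(tgt_inv gB) ?(src_inv gB) //.
by rewrite (mul_invl gB) -pq (mul_unitr gB).
Qed.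

Lemma mul_divm p q r : src B p = tgt B q -> src B q = src B r ->
  mul B p (divm B q r) = divm B (mul B p q) r.
Proof. by move=> pq qr; rewrite /divm (mul_assoc gB) // (tgt_inv gB). Qed.

Lemma tgt_divm p q : src B p = src B q -> tgt B (divm B p q) = tgt B p.
Proof. by move=> pq; rewrite /divm (tgt_mul gB) // (tgt_inv gB). Qed.

(** Since p = (p q^-1) q, one has p r^-1 = (p q^-1)(q r^-1), and q r^-1 cancels. Its derivative
    along a deformation is the cocycle equation. *)
Lemma divm_divm p q r : src B p = src B r -> src B q = src B r ->
  divm B (divm B p r) (divm B q r) = divm B p q.
Proof.
move=> pr qr; have pq : src B p = src B q by rewrite pr qr.
rewrite -[X in divm B (divm B X r)](divm_mulK pq) -mul_divm //; last first.
  by rewrite src_divm.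
by rewrite mul_invKr // src_divm // tgt_divm.
Qed.

End GroupoidAlgebra.

Lemma divm_eq (G M : Type) (B B' : groupoid_maps G M) p q :
  is_groupoid B -> groupoid_eq B B' -> src B p = src B q ->
  divm B p q = divm B' p q.
Proof.
by move=> gB [_ _ emul _ einv] pq; rewrite /divm -einv emul // (tgt_inv gB).
Qed.

Section Division.
Context {R : realType} {n m : nat} {G : manifold R n} {M : manifold R m}.
Variable A : groupoid_maps G M.
Hypothesis A_lie : is_lie_groupoid A.
Local Notation line := (model_space R^o).
Let gA := lie_is_groupoid A_lie.
Let fG : framed 'rV[R]_n := framed_rV n.
Let fGG := framed_prod fG fG.
Let fL := framed_line (R := R).
Local Notation GG := (prod_space G G).

Lemma divm_smooth :
  smooth_on (X := GG) [set z | src A z.1 = src A z.2] (fun z => divm A z.1 z.2).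
Proof.
move=> [p q] /= pq.
have s1 : smooth_at (X := GG) (Y := GG) (fun z => (z.1, inv A z.2)) (p, q).
  apply: smooth_at_pair; first exact: smooth_at_fst.
  apply: (smooth_at_comp (X := GG) (Y := G) (T := G) (f := snd)
    (g := inv A)) => //; first exact: smooth_at_snd.
  exact: inv_smooth.
apply: (smooth_within_comp (X := GG) (Y := GG)
  (f := fun z : GG => (z.1, inv A z.2)) (g := fun z : GG => mul A z.1 z.2)
  (S' := [set z | src A z.1 = tgt A z.2]) fGG fG) => //.
- by move=> [a b] /= ab; rewrite (tgt_inv gA).
- exact: smooth_at_within s1.
- by apply: (mul_smooth A_lie) => /=; rewrite (tgt_inv gA).
Qed.

(** At a given (p, q), [diff_divm] is the differential of one chosen extension, smooth on [GG] near
    (p, q). *)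
Lemma diff_divm_linear p q (a : R) (v v' : tangent p) (w w' : tangent q) :
  src A p = src A q ->
  diff_divm A (v + a *: v') (w + a *: w') =
  diff_divm A v w + a *: diff_divm A v' w'.
Proof.
move=> pq; rewrite /diff_divm /mdiff_within.
have [sF _] := xgetPex (fun z : GG => divm A z.1 z.2) (divm_smooth (x := (p, q)) pq).
exact: (mdiff_linear a (v, w) (v', w') sF).
Qed.

(** The chain rule applies to the chosen extension along [(c1, c2)]. The curve stays in the domain
    of division, so the extension may be replaced by [divm], and the value does not depend on the
    choice. *)
Lemma diff_divm_velocity (c1 c2 : line -> G) e :
  smooth_at c1 e -> smooth_at c2 e ->
  (\forall t \near e, src A (c1 t) = src A (c2 t)) ->
  diff_divm A (velocity c1 e) (velocity c2 e) =
  velocity (fun t => divm A (c1 t) (c2 t)) e.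
Proof.
move=> s1 s2 c12; have cc := nbhs_singleton c12.
rewrite /diff_divm /mdiff_within.
have [sF FE] := xgetPex (fun z : GG => divm A z.1 z.2)
  (divm_smooth (x := (c1 e, c2 e)) cc).
set F := xget _ _ in sF FE *.
rewrite -(velocity_pair fG fG s1 s2).
rewrite -[LHS](velocity_comp fGG (smooth_at_pair s1 s2) sF).
have nF := smooth_at_continuous (smooth_at_pair s1 s2) FE.
have nE : {near e, F \o (fun t => (c1 t, c2 t)) =1 fun t => divm A (c1 t) (c2 t)}.
  by apply: filterS2 c12 nF => t ct /= ->.
exact: velocity_ext nE.
Qed.

(** * Division maps of an s-constant deformation *)

Section Deformation.
Variables (I : set R) (D : R -> groupoid_maps G M).
Hypotheses (D_def : strict_deformation A I D) (D_s : s_constant A I D).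

Lemma deformation_nbhs0 : nbhs (0 : R^o) I.
Proof. by have [_ oI I0] := def_interval D_def; exact: open_nbhs_nbhs. Qed.

Lemma deformation_groupoid e : I e -> is_groupoid (D e).
Proof. by move=> Ie; have [] := def_lie_groupoid D_def Ie. Qed.

Lemma deformation_divm0 p q : src A p = src A q -> divm (D 0) p q = divm A p q.
Proof.
move=> pq; have I0 : I 0 := nbhs_singleton deformation_nbhs0.
by apply: (divm_eq (deformation_groupoid I0) (def_at0 D_def)); rewrite !(D_s I0).
Qed.

(** With a constant source map, all division maps share one domain; each is inversion of the second
    argument followed by multiplication, both smooth in the parameter too. *)
Lemma deformation_divm_smooth :
  smooth_on (X := prod_space line GG)
    [set z | I z.1 /\ src A z.2.1 = src A z.2.2]
    (fun z => divm (D z.1) z.2.1 z.2.2).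
Proof.
move=> [e [p q]] /= [Ie pq].
set S := [set z | _].
have Sx : S (e, (p, q)) by [].
have s0 : smooth_at (X := prod_space line GG) (Y := line) fst (e, (p, q)).
  exact: smooth_at_fst.
have s1 : smooth_at (X := prod_space line GG) (Y := GG) snd (e, (p, q)).
  exact: smooth_at_snd.
have s2 : smooth_at (X := prod_space line GG) (fst \o snd) (e, (p, q)).
  by apply: (smooth_at_comp (X := prod_space line GG) (Y := GG) (T := G)
    (f := snd) (g := fst)) => //; exact: smooth_at_fst.
have s3 : smooth_at (X := prod_space line GG) (snd \o snd) (e, (p, q)).
  by apply: (smooth_at_comp (X := prod_space line GG) (Y := GG) (T := G)
    (f := snd) (g := snd)) => //; exact: smooth_at_snd.
have s4 : smooth_within (X := prod_space line GG) S
    (fun z => inv (D z.1) z.2.2) (e, (p, q)).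
  apply: (smooth_within_comp (Y := prod_space line G)
    (f := fun z : prod_space line GG => (z.1, z.2.2))
    (g := fun z : prod_space line G => inv (D z.1) z.2)
    (S' := [set z | I z.1]) (framed_prod fL fG) fG Sx).
  - by move=> z [].
  - exact: smooth_at_within (smooth_at_pair s0 s3).
  - exact: def_inv_smooth D_def (e, q) Ie.
have invE z : S z -> src (D z.1) z.2.1 = tgt (D z.1) (inv (D z.1) z.2.2).
  by move=> [Iz zE]; rewrite (tgt_inv (deformation_groupoid Iz)) !(D_s Iz).
apply: (smooth_within_comp (Y := prod_space line GG)
    (f := fun z : prod_space line GG => (z.1, (z.2.1, inv (D z.1) z.2.2)))
    (g := fun z : prod_space line GG => mul (D z.1) z.2.1 z.2.2)
    (S' := [set z | I z.1 /\ src (D z.1) z.2.1 = tgt (D z.1) z.2.2])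
    (framed_prod fL fGG) fG Sx).
- move=> z Sz; split; first by case: Sz.
  exact (invE z Sz).
- apply: smooth_within_pair; first exact: smooth_at_within.
  by apply: smooth_within_pair => //; exact: smooth_at_within.
- by apply: (def_mul_smooth D_def); split => //; exact: (invE _ Sx).
Qed.

Lemma deformation_divm_curve (c1 c2 : line -> G) :
  smooth_at c1 0 -> smooth_at c2 0 ->
  (\forall t \near (0 : R^o), src A (c1 t) = src A (c2 t)) ->
  smooth_at (X := line) (fun t => divm (D t) (c1 t) (c2 t)) 0.
Proof.
move=> s1 s2 c12.
pose S := I `&` [set t | src A (c1 t) = src A (c2 t)].
have nS : nbhs (0 : R^o) S by apply: filterI => //; exact: deformation_nbhs0.
have S0 : S 0 := nbhs_singleton nS.
apply: (smooth_within_nbhs (X := line) nS).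
apply: (smooth_within_comp (X := line) (Y := prod_space line GG)
    (f := fun t : line => (t, (c1 t, c2 t)))
    (g := fun z : prod_space line GG => divm (D z.1) z.2.1 z.2.2)
    (S' := [set z | I z.1 /\ src A z.2.1 = src A z.2.2])
    (framed_prod fL fGG) fG S0).
- by move=> t [].
- apply: smooth_at_within; apply: smooth_at_curve_pair.
  exact: smooth_at_pair.
- exact: deformation_divm_smooth.
Qed.

(** [velocity_split] applied to a local extension [H] of the family of division maps. The base
    points [p] and [q] are separate variables because in the applications [c1 0] and [c2 0] equal
    them only propositionally. *)
Lemma velocity_divm (c1 c2 : line -> G) p q :
  c1 0 = p -> c2 0 = q -> smooth_at c1 0 -> smooth_at c2 0 ->
  (\forall t \near (0 : R^o), src A (c1 t) = src A (c2 t)) ->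
  velocity (fun t => divm (D t) (c1 t) (c2 t)) 0 =
  velocity (fun t => divm (D t) p q) 0 +
  diff_divm A (p := p) (q := q) (velocity c1 0) (velocity c2 0).
Proof.
move=> <- <- s1 s2 c12.
rewrite (diff_divm_velocity s1 s2 c12).
have I0 := deformation_nbhs0; have cc := nbhs_singleton c12.
have [|H [sH Hf]] := deformation_divm_smooth (x := (0, (c1 0, c2 0))).
  by split => //=; exact: nbhs_singleton I0.
have s12 := smooth_at_pair s1 s2.
have sid : smooth_at (X := line) (Y := line) id 0 by exact: smooth_at_id.
have sc0 : smooth_at (X := line) (fun=> 0 : line) 0 by exact: smooth_at_cst.
have scx : smooth_at (X := line) (Y := GG) (fun=> (c1 0, c2 0)) 0.
  exact: smooth_at_cst.
have := velocity_split fGG fG s12 sH.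
have n1 : \forall t \near (0 : R^o), H (t, (c1 t, c2 t)) = divm (D t) (c1 t) (c2 t).
  have nH := smooth_at_continuous (smooth_at_pair sid s12) Hf.
  apply: filterS3 I0 c12 nH => t It ct /= Ht; exact: Ht.
have n2 : \forall t \near (0 : R^o), H (t, (c1 0, c2 0)) = divm (D t) (c1 0) (c2 0).
  have nH := smooth_at_continuous (smooth_at_pair sid scx) Hf.
  apply: filterS2 I0 nH => t It /= Ht; exact: Ht.
(* With the parameter frozen at 0, [H] is the division of [D 0], which agrees with that of [A] on
   pairs of equal source. *)
have n3 : \forall t \near (0 : R^o), H (0, (c1 t, c2 t)) = divm A (c1 t) (c2 t).
  have nH := smooth_at_continuous (smooth_at_pair sc0 s12) Hf.
  apply: filterS2 c12 nH => t ct /= Ht; rewrite Ht ?deformation_divm0 //.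
  by split => //; exact: nbhs_singleton I0.
by rewrite (velocity_ext n1) (velocity_ext n2) (velocity_ext n3).
Qed.

End Deformation.
End Division.

(** * The deformation complex *)

Section LinearLifts.
Context {R : realType} {V W : normedModType R}.
Context {X : smooth_space V} {Y : smooth_space W}.
Implicit Types (S : set X) (b : X -> Y).

Lemma smooth_at_linear (f g : X -> model_space W) x (r : R) :
  framed W -> smooth_at f x -> smooth_at g x ->
  smooth_at (Y := model_space W) (fun y => f y + r *: g y) x.
Proof.
move=> fW sf sg; split.
  apply: filterS2 (smooth_at_near_continuous sf) (smooth_at_near_continuous sg).
  move=> y cf cg; apply: (@cvgD _ W _ (nbhs y)) => //.
  exact: (@cvgZl_tmp _ W _ (nbhs y)).
have cr : continuous ( *:%R r : W -> W) by exact: scaler_continuous.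
apply: Coo_nearD; first exact: (smooth_at_coo sf).
exact: (Coo_near_comp fW fW (smooth_at_coo sg) (Coo_near_linear _ cr)).
Qed.

(** [tangent_coord] in the chart at [b x0] is the differential of a transition map, hence linear,
    once [b x] lies in the domain of that chart. *)
Lemma smooth_lift_linear S b (c c' : forall x, tangent (b x)) (r : R) :
  framed W -> smooth_lift S c -> smooth_lift S c' ->
  smooth_lift S (b := b) (fun x => c x + r *: c' x).
Proof.
move=> fW [sb sc] [_ sc']; split=> // x0 Sx0.
have [F [sF Fc]] := sc x0 Sx0; have [F' [sF' Fc']] := sc' x0 Sx0.
exists (fun x => F x + r *: F' x); split; first exact: smooth_at_linear.
(* Continuity of the extension [B] keeps [b x] in the chart for [x] in [S] near [x0]. *)
have [B [sB Bb]] := sb x0 Sx0.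
have nB : \forall x \near x0, chart_dom (chart_at (b x0)) (B x).
  have nd : nbhs (B x0) (chart_dom (chart_at (b x0))).
    by rewrite (nbhs_singleton Bb Sx0); exact: near_chart_dom (chart_at_dom _).
  exact: smooth_at_continuous sB _ nd.
near=> x => Sx.
have bx : chart_dom (chart_at (b x0)) (b x).
  have <- : B x = b x by apply: (near Bb x).
  by near: x.
have -> : F x = tangent_coord (chart_at (b x0)) (c x) by apply: (near Fc x).
have -> : F' x = tangent_coord (chart_at (b x0)) (c' x) by apply: (near Fc' x).
have dT := Coo_near_differentiable (Coo_near_transition (chart_at_atlas (b x))
  (chart_at_atlas (b x0)) (chart_at_dom (b x)) bx).
by rewrite /tangent_coord !(deriveE _ dT) linearD linearZ.
Unshelve. all: by end_near. Qed.

End LinearLifts.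

(** The shape of [delta], with linearity of its division term as hypothesis. The abstract module
    replaces tangent spaces at different base points. *)
Lemma linear_alternating_sum (R : realType) (V : lmodType R) (e : R) (r : R)
    (f f' : nat -> V) (z z' : V) (i j : nat) (u u' w : V) : w = u + r *: u' ->
  - w + \sum_(i <= l < j) (-1) ^+ l.+1 *: (f l + r *: f' l) + e *: (z + r *: z') =
  - u + \sum_(i <= l < j) (-1) ^+ l.+1 *: f l + e *: z +
  r *: (- u' + \sum_(i <= l < j) (-1) ^+ l.+1 *: f' l + e *: z').
Proof.
move=> ->; have sumE : \sum_(i <= l < j) (-1) ^+ l.+1 *: (f l + r *: f' l) =
    \sum_(i <= l < j) (-1) ^+ l.+1 *: f l +
    r *: \sum_(i <= l < j) (-1) ^+ l.+1 *: f' l.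
  rewrite scaler_sumr -big_split; apply: eq_bigr => l _.
  by rewrite scalerDr !scalerA mulrC.
rewrite sumE !scalerDr scalerN opprD [e *: (r *: z')]scalerA [e * r]mulrC.
rewrite -[(r * e) *: z']scalerA.
by rewrite [- u - _ + _]addrACA [LHS]addrACA.
Qed.

Section Cochains.
Context {R : realType} {n m : nat} {G : manifold R n} {M : manifold R m}.
Variable A : groupoid_maps G M.
Hypothesis A_lie : is_lie_groupoid A.
Let gA := lie_is_groupoid A_lie.

Lemma is_cochain_linear k (b b' : cochain (G := G) k) (r : R) :
  is_cochain A b -> is_cochain A b' ->
  is_cochain A (fun x => b x + r *: b' x : tangent (first_arrow x)).
Proof.
move=> [sb tb] [sb' tb']; split; first exact: (smooth_lift_linear r (framed_rV n) sb sb').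
move=> x y Cx Cy xy.
have lin (z : gpow G k) : mdiff (src A) (b z + r *: b' z : tangent (first_arrow z)) =
    mdiff (src A) (b z) + r *: mdiff (src A) (b' z).
  exact: mdiff_linear (src_smooth A_lie _).
rewrite (lin x) (lin y) (tb x y Cx Cy xy) (tb' x y Cx Cy xy); reflexivity.
Qed.

(** The two arguments of the division term in [delta] are based at these arrows; [diff_divm_linear]
    asks for their common source. *)
Lemma src_contract_tail k (x : gpow G k.+1) : composable A x ->
  src A (first_arrow (contract A 0 x)) = src A (first_arrow (tail x)).
Proof.
by case: k x => [|k] /= x [xy _]; rewrite (src_mul gA).
Qed.

Lemma delta_linear k (b b' : cochain (G := G) k) (r : R) x : composable A x ->
  delta A (fun x => b x + r *: b' x : tangent (first_arrow x)) x =
  delta A b x + r *: delta A b' x.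
Proof.
move=> Cx; have lin := diff_divm_linear A_lie r (b (contract A 0 x))
  (b' (contract A 0 x)) (b (tail x)) (b' (tail x)) (src_contract_tail Cx).
pose W : normedModType R := 'rV[R]_n.
pose X := @linear_alternating_sum R W ((-1) ^+ k.+2) r
  (fun i => b (contract A i x)) (fun i => b' (contract A i x))
  (b (drop_last x)) (b' (drop_last x)) 1 k.+1.
exact: X lin.
Qed.

(** As c'' - c' = (c'' - c) - (c' - c), the cobounding cochain is corrected by [b0], subtracted for
    one inclusion and added for the other. *)
Lemma cohomology_class_eq k (c c' : cochain (G := G) k.+1) (b0 : cochain (G := G) k) :
  is_cochain A b0 ->
  (forall x, composable A x -> c' x - c x = delta A b0 x) ->
  cohomology_class A c = cohomology_class A c'.
Proof.
move=> cb0 E; apply/seteqP; split=> c'' [cc [b [cb Eb]]]; split=> //.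
- exists (fun x => b x + (-1) *: b0 x); split; first exact: is_cochain_linear.
  move=> x Cx; rewrite delta_linear // -Eb // -E // scaleN1r opprB.
  by rewrite addrA subrK.
- exists (fun x => b x + 1 *: b0 x); split; first exact: is_cochain_linear.
  move=> x Cx; rewrite delta_linear // -Eb // -E // scale1r.
  by rewrite addrA subrK.
Qed.

End Cochains.

(** * The class of an s-constant deformation *)

Section Cocycle.
Context {R : realType} {n m : nat} {G : manifold R n} {M : manifold R m}.
Variable A : groupoid_maps G M.
Hypothesis A_lie : is_lie_groupoid A.
Local Notation line := (model_space R^o).
Let gA := lie_is_groupoid A_lie.
Let fG : framed 'rV[R]_n := framed_rV n.
Let fGG := framed_prod fG fG.
Let fL := framed_line (R := R).
Local Notation GG := (prod_space G G).

Section Deformation.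
Variables (I : set R) (D : R -> groupoid_maps G M).
Hypotheses (D_def : strict_deformation A I D) (D_s : s_constant A I D).
Let I0 := deformation_nbhs0 D_def.

(** The curve defining xi_0(g, h) starts at g, so its velocity lies in T_g G. *)
Lemma deformation_divm_arrow g h : src A g = tgt A h ->
  divm (D 0) (mul A g h) h = g.
Proof.
move=> gh; rewrite (deformation_divm0 D_def D_s) ?(src_mul gA) //.
exact: (mul_invKr gA).
Qed.

Lemma deformation_divm_cst_curve p q : src A p = src A q ->
  smooth_at (X := line) (fun t => divm (D t) p q) 0.
Proof.
move=> pq; apply: (deformation_divm_curve D_def D_s (c1 := fun=> p) (c2 := fun=> q)).
- exact: smooth_at_cst.
- exact: smooth_at_cst.
- by near=> t.
Unshelve. all: by end_near. Qed.

Lemma xi0_smooth_lift : smooth_lift (composable A (k := 1)) (xi0 A D).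
Proof.
apply: (smooth_lift_velocity (X := GG) (I := I) (b := @first_arrow R n G 1)
  (f := fun t x => divm (D t) (mul A x.1 x.2) x.2)) => //.
- by move=> [g h] [/= gh _]; exact: deformation_divm_arrow.
- move=> [e [g h]] Se; have [/= Ie [/= gh _]] := Se.
  set S := (I `*` _) in Se *.
  have s0 : smooth_at (X := prod_space line GG) (Y := line) fst (e, (g, h)).
    exact: smooth_at_fst.
  have s1 : smooth_at (X := prod_space line GG) (Y := GG) snd (e, (g, h)).
    exact: smooth_at_snd.
  have s3 : smooth_at (X := prod_space line GG) (snd \o snd) (e, (g, h)).
    by apply: (smooth_at_comp (X := prod_space line GG) (Y := GG) (T := G)
      (f := snd) (g := snd)) => //; exact: smooth_at_snd.
  have s4 : smooth_within (X := prod_space line GG) S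
      (fun z => mul A z.2.1 z.2.2) (e, (g, h)).
    apply: (smooth_within_comp (X := prod_space line GG) (Y := GG) (f := snd)
      (g := fun z : GG => mul A z.1 z.2)
      (S' := [set z | src A z.1 = tgt A z.2]) fGG fG Se).
    + by move=> z [_ []].
    + exact: smooth_at_within.
    + exact: (mul_smooth A_lie).
  apply: (smooth_within_comp (X := prod_space line GG) (Y := prod_space line GG)
    (f := fun z : prod_space line GG => (z.1, (mul A z.2.1 z.2.2, z.2.2)))
    (g := fun z : prod_space line GG => divm (D z.1) z.2.1 z.2.2)
    (S' := [set z | I z.1 /\ src A z.2.1 = src A z.2.2])
    (framed_prod fL fGG) fG Se).
  + by move=> z [Iz [zc _]]; split => //=; rewrite (src_mul gA).
  + apply: smooth_within_pair; first exact: smooth_at_within.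
    by apply: smooth_within_pair => //; exact: smooth_at_within.
  + by apply: (deformation_divm_smooth D_def D_s); split => //=; rewrite (src_mul gA).
- move=> x _; apply: smooth_at_within; exact: smooth_at_fst.
Qed.

(** The source of mbar_e(gh, h) is t_e(h), and [src A] is the source map of every [D e] with e in
    [I]. The result involves h only, as a cochain requires. *)
Lemma src_xi0 g h : src A g = tgt A h ->
  mdiff (x := g) (src A) (xi0 A D (g, h)) = velocity (fun t => tgt (D t) h) 0.
Proof.
move=> gh; rewrite /xi0 /=; set c : line -> G := fun t => divm (D t) (mul A g h) h.
have c0 : c 0 = g by exact: deformation_divm_arrow.
have sp : src A (mul A g h) = src A h by rewrite (src_mul gA).
have sc : smooth_at c 0 by exact: deformation_divm_cst_curve.
have E := velocity_comp fG sc (src_smooth A_lie (c 0)).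
have n0 : {near (0 : R^o), src A \o c =1 fun t => tgt (D t) h}.
  apply: filterS I0 => t It /=.
  by rewrite -(D_s It) (src_divm (deformation_groupoid D_def It)) // !(D_s It).
rewrite -(velocity_ext n0) E c0; reflexivity.
Qed.

Lemma xi0_cochain : is_cochain A (xi0 A D).
Proof.
split; first exact: xi0_smooth_lift.
move=> [g h] [g' h'] [/= gh _] [/= gh' _] hh'; rewrite /= in hh'.
by rewrite hh' in gh *; rewrite !src_xi0.
Qed.

(** [velocity_divm] along mbar_e(ghk, k) and mbar_e(hk, k), based at gh and h, gives xi_0(g, hk) =
    xi_0(g, h) + d mbar(xi_0(gh, k), xi_0(h, k)). *)
Lemma delta_xi0 (x : gpow G 2) : composable A x -> delta A (xi0 A D) x = 0.
Proof.
case: x => g [h k] [/= gh [/= hk _]].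
have ghk : src A (mul A g h) = tgt A k by rewrite (src_mul gA).
have ghk' : src A g = tgt A (mul A h k) by rewrite (tgt_mul gA).
rewrite /delta /= big_nat1 /=.
pose c1 : line -> G := fun t => divm (D t) (mul A (mul A g h) k) k.
pose c2 : line -> G := fun t => divm (D t) (mul A h k) k.
have c10 : c1 0 = mul A g h by exact: deformation_divm_arrow.
have c20 : c2 0 = h by exact: deformation_divm_arrow.
have e1 : src A (mul A (mul A g h) k) = src A k by rewrite (src_mul gA).
have e2 : src A (mul A h k) = src A k by rewrite (src_mul gA).
have s1 : smooth_at c1 0 by exact: deformation_divm_cst_curve.
have s2 : smooth_at c2 0 by exact: deformation_divm_cst_curve.
(* Both curves have source t_e(k). *)
have c12 : \forall t \near (0 : R^o), src A (c1 t) = src A (c2 t).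
  apply: filterS I0 => t It; have gt := deformation_groupoid D_def It.
  by rewrite -!(D_s It) !(src_divm gt) ?(D_s It).
have := velocity_divm A_lie D_def D_s c10 c20 s1 s2 c12.
have nE : {near (0 : R^o), (fun t => divm (D t) (c1 t) (c2 t)) =1
    fun t => divm (D t) (mul A g (mul A h k)) (mul A h k)}.
  apply: filterS I0 => t It; have gt := deformation_groupoid D_def It.
  by rewrite (divm_divm gt) ?(D_s It) // (mul_assoc gA).
rewrite (velocity_ext nE) => E.
(* Here [u] is the division term, [v] is xi_0(g, h) and [w] is xi_0(g, hk). *)
have aux (W : lmodType R) (u v w : W) : w = v + u ->
    - u + (-1) ^+ 2 *: w + (-1) ^+ 3 *: v = 0.
  by move=> ->; rewrite sqrrN expr1n scale1r exprS sqrrN expr1n mulr1 scaleN1r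
    [v + u]addrC addKr subrr.
exact: (aux ('rV[R]_n : normedModType R) _ _ _ E).
Qed.

End Deformation.
Lemma xi0_cocycle (I : set R) (D : R -> groupoid_maps G M) :
  strict_deformation A I D -> s_constant A I D -> is_cocycle A (xi0 A D).
Proof.
by move=> D_def D_s; split; [exact: xi0_cochain D_def D_s | exact: delta_xi0 D_def D_s].
Qed.

(** * Equivalent deformations have cohomologous cocycles *)

Section Equivalence.
Variables (I I' J : set R) (D D' : R -> groupoid_maps G M).
Hypotheses (D_def : strict_deformation A I D) (D_s : s_constant A I D).
Hypotheses (D_def' : strict_deformation A I' D') (D_s' : s_constant A I' D').
Variables (Phi : R -> G -> G) (phi : R -> M -> M).
Hypotheses (oJ : open_interval_at0 J) (JI : J `<=` I `&` I').
Hypothesis Phi_smooth :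
  smooth_on (X := prod_space line G) [set p | J p.1] (fun p => Phi p.1 p.2).
Hypothesis Phi_iso : forall e, J e -> lie_groupoid_iso (D e) (D' e) (Phi e) (phi e).
Hypothesis Phi0 : Phi 0 =1 id.

(** Index 0 means degree 1. The velocity is taken at [Phi 0 g], which [Phi0] identifies with [g]. *)
Let X : cochain (G := G) 0 := fun g => velocity (Phi ^~ g) 0.

Let J0 : nbhs (0 : R^o) J.
Proof. by have [_ opJ J0] := oJ; exact: open_nbhs_nbhs. Qed.

Let src_Phi e g : J e -> src A (Phi e g) = phi e (src A g).
Proof.
move=> Je; have [Ie I'e] := JI Je; have [_ _ sPhi _ _] := Phi_iso Je.
by rewrite -(D_s' I'e) sPhi (D_s Ie).
Qed.

(** Derived from multiplicativity: apply [Phi e] to p = (p q^-1) q and cancel the image of q on the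
    right. *)
Let Phi_divm e p q : J e -> src A p = src A q ->
  Phi e (divm (D e) p q) = divm (D' e) (Phi e p) (Phi e q).
Proof.
move=> Je pq; have [Ie I'e] := JI Je; have [_ _ sPhi tPhi mPhi] := Phi_iso Je.
have gD := deformation_groupoid D_def Ie; have gD' := deformation_groupoid D_def' I'e.
have pqe : src (D e) p = src (D e) q by rewrite !(D_s Ie).
rewrite -{2}(divm_mulK gD pqe) mPhi ?(src_divm gD) //.
by rewrite (mul_invKr gD') // sPhi tPhi (src_divm gD).
Qed.

Let smooth_Phi_curve g : smooth_at (X := line) (Phi ^~ g) 0.
Proof.
apply: (smooth_within_nbhs (X := line) J0).
apply: (smooth_within_comp (X := line) (Y := prod_space line G)
  (f := fun t : line => (t, g)) (g := fun z : prod_space line G => Phi z.1 z.2)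
  (S' := [set z | J z.1]) (framed_prod fL fG) fG (nbhs_singleton J0)) => //.
- apply: smooth_at_within; apply: smooth_at_curve_pair; exact: smooth_at_cst.
- by apply: Phi_smooth; exact: nbhs_singleton J0.
Qed.

(** Both source maps are [src A], so s(Phi_e(g)) = phi_e(s(g)), and ds sends X(g) to the velocity of
    phi_e at s(g), which depends only on s(g). *)
Lemma equivalence_cochain : is_cochain A X.
Proof.
split.
  apply: (smooth_lift_velocity (X := G) (I := J) (b := @first_arrow R n G 0)
    (f := Phi)) => //.
  - by move=> z [Jz _]; apply: smooth_within_sub (@Phi_smooth z Jz) => y [].
  - by move=> g _; apply: smooth_at_within; exact: smooth_at_id.
have E (g : G) : mdiff (x := g) (src A) (X g) = velocity (phi ^~ (src A g)) 0.
  have := velocity_comp fG (smooth_Phi_curve g) (src_smooth A_lie (Phi 0 g)).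
  rewrite Phi0 => <-.
  have n0 : {near (0 : R^o), src A \o Phi ^~ g =1 phi ^~ (src A g)}.
    by apply: filterS J0 => t Jt /=; exact: src_Phi.
  exact: velocity_ext n0.
by move=> g g' _ _ gg'; rewrite !E gg'.
Qed.

(** The velocity of Phi_e(mbar_e(gh, h)) is computed twice: [velocity_split] gives X(g) + xi_0(g,
    h), and [velocity_divm] for [D'] gives xi'_0(g, h) + d mbar(X(gh), X(h)). *)
Lemma xi0_sub_equivalence (x : gpow G 1) : composable A x ->
  xi0 A D' x - xi0 A D x = delta A X x.
Proof.
case: x => g h [/= gh _].
have e1 : src A (mul A g h) = src A h by rewrite (src_mul gA).
pose c : line -> G := fun t => divm (D t) (mul A g h) h.
have c0 : c 0 = g by exact: (deformation_divm_arrow D_def D_s).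
have sc : smooth_at c 0 by exact: (deformation_divm_cst_curve D_def D_s).
have [|F [sF FE]] := Phi_smooth (x := (0, c 0)); first exact: nbhs_singleton J0.
(* The extension [F] may be replaced by [Phi] along any smooth curve through [c 0]; needed for [c]
   and for the constant curve. *)
have nJ (k : line -> G) : smooth_at k 0 -> k 0 = c 0 ->
    {near (0 : R^o), (fun t => F (t, k t)) =1 fun t => Phi t (k t)}.
  move=> sk k0; have sk' := smooth_at_continuous (smooth_at_curve_pair sk).
  have nF := sk' [set z | J z.1 -> F z = Phi z.1 z.2].
  rewrite k0 in nF.
  by apply: filterS2 J0 (nF FE) => t Jt /=; exact.
have n1 := nJ c sc erefl.
have n2 := nJ (fun=> c 0) (smooth_at_cst _ _) erefl.
have n3 : {near (0 : R^o), (fun t => F (0, c t)) =1 c}.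
  have s0 : smooth_at (X := line) (fun=> 0 : line) 0 by exact: smooth_at_cst.
  have nF : \forall t \near (0 : R^o), J 0 -> F (0, c t) = Phi 0 (c t).
    exact: smooth_at_continuous (smooth_at_pair s0 sc) _ FE.
  by apply: filterS nF => t /= ->; [exact: Phi0 | exact: nbhs_singleton J0].
have E1 := velocity_split fG fG sc sF.
rewrite (velocity_ext n1) (velocity_ext n2) (velocity_ext n3) in E1.
have n4 : {near (0 : R^o), (fun t => Phi t (c t)) =1
    fun t => divm (D' t) (Phi t (mul A g h)) (Phi t h)}.
  by apply: filterS J0 => t Jt /=; exact: Phi_divm.
have n5 : \forall t \near (0 : R^o), src A (Phi t (mul A g h)) = src A (Phi t h).
  by apply: filterS J0 => t Jt; rewrite !src_Phi // e1.
have E2 := velocity_divm A_lie D_def' D_s' (Phi0 (mul A g h)) (Phi0 h)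
  (smooth_Phi_curve (mul A g h)) (smooth_Phi_curve h) n5.
rewrite (velocity_ext n4) c0 in E1.
have E := etrans (esym E1) E2.
(* In degree 1 the middle sum of [delta] is empty. Here [a] is X(g), [b] and [d] are xi_0 and xi'_0
   at (g, h), and [u] is the division term. *)
have aux (W : lmodType R) (f : nat -> W) (a b d u : W) : a + b = d + u ->
    d - b = - u + \sum_(1 <= i < 1) (-1) ^+ i.+1 *: f i + (-1) ^+ 2 *: a.
  move=> abdu; rewrite big_geq // addr0 sqrrN expr1n scale1r.
  have -> : d = a + b - u by rewrite abdu addrK.
  by rewrite addrAC addrK addrC.
exact: (aux ('rV[R]_n : normedModType R) (fun i => X (contract A i (g, h))) _ _ _ _ E).
Qed.

End Equivalence.
End Cocycle.

Theorem lemma5p3 (R : realType) (n m : nat) (G : manifold R n) (M : manifold R m)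
    (A : groupoid_maps G M) (A_lie : is_lie_groupoid A)
    (I : set R) (D : R -> groupoid_maps G M)
    (D_def : strict_deformation A I D) (D_s : s_constant A I D) :
  is_cocycle A (xi0 A D) /\
  (forall (I' : set R) (D' : R -> groupoid_maps G M),
     strict_deformation A I' D' -> s_constant A I' D' ->
     equivalent_deformations I D I' D' ->
     cohomology_class A (xi0 A D) = cohomology_class A (xi0 A D')).
Proof.
split; first by exact: (xi0_cocycle A_lie D_def D_s).
move=> I' D' D_def' D_s' [J [Phi [phi [oJ JI [sPhi _] iso [Phi0 _]]]]].
apply: (cohomology_class_eq A_lie
  (equivalence_cochain A_lie D_s D_s' oJ JI sPhi iso Phi0)).
exact: (xi0_sub_equivalence A_lie D_def D_s D_def' D_s' oJ JI sPhi iso Phi0).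
Qed.
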